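(* Up to isomorphism there are $19$ complex Jordan superalgebras of type $(1,3)$. With even basis vector $e$ and odd basis vectors $f_1,f_2,f_3$, they are listed below; in square brackets are given the orbit dimension and the decomposition into indecomposables (''Indec.'' means indecomposable): $\mathbf J_1$ [$6$; $\mathcal S_2^3\oplus\mathcal S_1^1$]: $f_1f_2=e$; $\mathbf J_2$ [$6$; $\mathcal S_3^3\oplus\mathcal S_1^1$]: $ef_1=f_2$; $\mathbf J_3$ [$9$; $\mathcal S_1^3\oplus\mathcal S_1^1$]: $ef_1=f_2,\ f_1f_2=e$; $\mathbf J_4$ [$9$; Indec.]: $ef_1=f_2,\ f_1f_3=e$; $\mathbf J_5$ [$12$; Indec.]: $ef_1=f_2,\ f_2f_3=e$; $\mathbf J_6$ [$11$; Indec.]: $ef_1=f_2,\ ef_2=f_3$; $\mathbf J_7$ [$7$; $\mathcal U_1\oplus\mathcal S_1^1\oplus\mathcal S_1^1\oplus\mathcal S_1^1$]: $e^2=e$; $\mathbf J_8$ [$10$; $\mathcal S_1^2\oplus\mathcal S_1^1\oplus\mathcal S_1^1$]: $e^2=e,\ ef_3=\frac12f_3$; $\mathbf J_9$ [$10$; $\mathcal S_2^2\oplus\mathcal S_1^1\oplus\mathcal S_1^1$]: $e^2=e,\ ef_3=f_3$; $\mathbf J_{10}$ [$9$; $\mathcal S_5^3\oplus\mathcal S_1^1$]: $e^2=e,\ ef_2=\frac12f_2,\ ef_3=\frac12f_3$; $\mathbf J_{11}$ [$10$; $\mathcal S_7^3\oplus\mathcal S_1^1$]: $e^2=e,\ ef_2=\frac12f_2,\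 ef_3=\frac12f_3,\ f_2f_3=e$; $\mathbf J_{12}$ [$12$; $\mathcal S_4^3\oplus\mathcal S_1^1$]: $e^2=e,\ ef_2=\frac12f_2,\ ef_3=f_3$; $\mathbf J_{13}$ [$11$; $\mathcal S_6^3\oplus\mathcal S_1^1$]: $e^2=e,\ ef_2=f_2,\ ef_3=f_3$; $\mathbf J_{14}$ [$12$; $\mathcal S_8^3\oplus\mathcal S_1^1$]: $e^2=e,\ ef_2=f_2,\ ef_3=f_3,\ f_2f_3=e$; $\mathbf J_{15}$ [$4$; Indec.]: $e^2=e,\ ef_1=\frac12f_1,\ ef_2=\frac12f_2,\ ef_3=\frac12f_3$; $\mathbf J_{16}$ [$9$; Indec.]: $e^2=e,\ ef_1=\frac12f_1,\ ef_2=\frac12f_2,\ ef_3=f_3$; $\mathbf J_{17}$ [$10$; Indec.]: $e^2=e,\ ef_1=\frac12f_1,\ ef_2=f_2,\ ef_3=f_3$; $\mathbf J_{18}$ [$7$; Indec.]: $e^2=e,\ ef_1=f_1,\ ef_2=f_2,\ ef_3=f_3$; $\mathbf J_{19}$ [$10$; Indec.]: $e^2=e,\ ef_1=f_1,\ ef_2=f_2,\ ef_3=f_3,\ f_1f_2=e$.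
   Context: All vector spaces are over $\mathbb C$. A superalgebra is a $\mathbb Z_2$-graded algebra $\mathfrak J=\mathfrak J_0\oplus\mathfrak J_1$ with $\mathfrak J_i\mathfrak J_j\subseteq\mathfrak J_{i+j}$; its type is $(\dim\mathfrak J_0,\dim\mathfrak J_1)$; $|x|=i$ for $x\in\mathfrak J_i$. It is a Jordan superalgebra if for all homogeneous $x,y,z,t$: $xy=(-1)^{|x||y|}yx$ and $$((xy)z)t+(-1)^{|y||z|+|y||t|+|z||t|}((xt)z)y+(-1)^{|x||y|+|x||z|+|x||t|+|z||t|}((yt)z)x=(xy)(zt)+(-1)^{|t|(|y|+|z|)}(xt)(yz)+(-1)^{|y||z|}(xz)(yt).$$ Isomorphisms are grading-preserving algebra isomorphisms. Multiplication tables list only nonzero products of basis vectors, up to supercommutativity ($ef_j=f_je$, $f_if_j=-f_jf_i$); all unlisted products are zero. The orbit dimension is calculated by the formula $\dim O=n^2-\dim\mathrm{Der}(\mathfrak J)$, where $n=4$ is the dimension of the superalgebra and $\mathrm{Der}(\mathfrak J)$ is the Lie algebra of derivations, spanned by the homogeneous linear maps $D$ (with $|D|=0$ if $D$ preserves the grading and $|D|=1$ otherwise) satisfying $D(xy)=D(x)y+(-1)^{|D||x|}xD(y)$. The summands in the decompositions are the following indecomposable (super)algebras, with $e$ even and $f,f_1,f_2$ odd: $\mathcal U_1$: $e^2=e$ (one-dimensional, even); $\mathcal S_1^1$: $f^2=0$ (one-dimensional, odd); $\mathcal S_1^2$: $e^2=e,\ ef=\frac12f$; $\mathcal S_2^2$: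 $e^2=e,\ ef=f$; and, with basis $e,f_1,f_2$: $\mathcal S_1^3$: $ef_1=f_2,\ f_1f_2=e$; $\mathcal S_2^3$: $f_1f_2=e$; $\mathcal S_3^3$: $ef_1=f_2$; $\mathcal S_4^3$: $e^2=e,\ ef_1=f_1,\ ef_2=\frac12f_2$; $\mathcal S_5^3$: $e^2=e,\ ef_1=\frac12f_1,\ ef_2=\frac12f_2$; $\mathcal S_6^3$: $e^2=e,\ ef_1=f_1,\ ef_2=f_2$; $\mathcal S_7^3$: $e^2=e,\ ef_1=\frac12f_1,\ ef_2=\frac12f_2,\ f_1f_2=e$; $\mathcal S_8^3$: $e^2=e,\ ef_1=f_1,\ ef_2=f_2,\ f_1f_2=e$.
   Formalization: The superalgebra of type (1,3) with all products zero is Jordan but not in the list, so the classification is stated for nonzero multiplication; the orbit dimensions of J_2 and J_3, printed as 6 and 9, are corrected to 7 and 10, the values given by n^2 - dim Der. *)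

(* Defs.v *)
From HB Require Import structures.
From mathcomp Require Import all_boot all_order all_algebra.
From mathcomp Require Import boolp reals complex.

Set Implicit Arguments.
Unset Strict Implicit.
Unset Printing Implicit Defensive.

Import GRing.Theory.
Local Open Scope ring_scope.

Section SetSpan.
Variables (F : fieldType) (V : vectType F).

Definition is_span (P : V -> Prop) (U : {vspace V}) : Prop :=
  (forall v, P v -> v \in U) /\
  (forall W : {vspace V}, (forall v, P v -> v \in W) -> (U <= W)%VS).

Fact is_span_exists (P : V -> Prop) : exists U, is_span P U.
Proof.
suff: forall n (U : {vspace V}), (\dim {:V} - \dim U <= n)%N ->
    (forall W : {vspace V}, (forall v, P v -> v \in W) -> (U <= W)%VS) ->
    exists U', is_span P U'.
  by move=> /(_ _ 0%VS (leqnn _)); apply=> W _; exact: sub0v.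
elim=> [|n IHn] U leUn minU;
  have [allU|/existsNP[v /not_implyP[Pv /negP vU]]] :=
    pselect (forall v, P v -> v \in U); first by exists U.
- by case/negP: vU; have /eqP-> : U == fullv;
    rewrite ?memvf // eqEdim subvf -subn_eq0 -leqn0.
- by exists U.
apply: (IHn (U + <[v]>)%VS) => [|W PW]; last first.
  by rewrite subv_add minU //=; exact: PW.
have ltU : (\dim U < \dim (U + <[v]>)%VS)%N.
  rewrite (ltn_leqif (dimv_leqif_sup (addvSl U <[v]>%VS))) subv_add subvv /=.
  exact: vU.
have := dimvS (subvf (U + <[v]>)%VS).
by move: leUn; rewrite !leq_subLR; move: ltU; move=> h1 h2 h3;
  rewrite (leq_trans h2) // addnS -addSn leq_add2r.
Qed.

Definition set_span (P : V -> Prop) : {vspace V} := sval (cid (is_span_exists P)).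

Fact set_spanP (P : V -> Prop) : is_span P (set_span P).
Proof. by rewrite /set_span; case: cid. Qed.

End SetSpan.

(* The degree in Z_2 is a boolean: [false] is even, [true] is odd, and the     *)
(* addition of Z_2 is the exclusive or [(+)].                                  *)
Record superalgebra (F : fieldType) := Superalgebra {
  sa_sort :> vectType F;
  sa_mul : {bilinear sa_sort -> sa_sort -> sa_sort};
  sa_gr : bool -> {vspace sa_sort};
  sa_span : (sa_gr false + sa_gr true = fullv)%VS;
  sa_direct : (sa_gr false :&: sa_gr true = 0)%VS;
  sa_graded : forall (i j : bool) (x y : sa_sort),
    x \in sa_gr i -> y \in sa_gr j -> sa_mul x y \in sa_gr (i (+) j)
}.

Arguments sa_gr {F} A i : rename.
Notation "x ** y" := (sa_mul _ x y) (at level 40, left associativity) : ring_scope.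

Section Theory.
Variable F : fieldType.
Implicit Types A B C : superalgebra F.

Definition has_type A (m n : nat) : Prop :=
  \dim (sa_gr A false) = m /\ \dim (sa_gr A true) = n.

Definition supercommutative A : Prop :=
  forall (i j : bool) (x y : A), x \in sa_gr A i -> y \in sa_gr A j ->
    x ** y = (-1) ^+ (i * j) *: (y ** x).

Definition jordan_identity A : Prop :=
  forall (i j k l : bool) (x y z t : A),
    x \in sa_gr A i -> y \in sa_gr A j -> z \in sa_gr A k -> t \in sa_gr A l ->
    ((x ** y) ** z) ** t
      + (-1) ^+ (j * k + j * l + k * l) *: (((x ** t) ** z) ** y)
      + (-1) ^+ (i * j + i * k + i * l + k * l) *: (((y ** t) ** z) ** x)
    = (x ** y) ** (z ** t)
      + (-1) ^+ (l * (j + k)) *: ((x ** t) ** (y ** z))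
      + (-1) ^+ (j * k) *: ((x ** z) ** (y ** t)).

Definition jordan_superalgebra A : Prop := supercommutative A /\ jordan_identity A.

Definition nonzero_product A : Prop := exists x y : A, x ** y != 0.

Definition sa_iso A B : Prop :=
  exists f : 'Hom(A, B),
    [/\ bijective f,
        forall x y, f (x ** y) = f x ** f y
      & forall i, (f @: sa_gr A i)%VS = sa_gr B i].

Definition derivation A (d : bool) (D : 'End(A)) : Prop :=
  (forall i, (D @: sa_gr A i <= sa_gr A (d (+) i))%VS) /\
  (forall i (x y : A), x \in sa_gr A i ->
     D (x ** y) = D x ** y + (-1) ^+ (d * i) *: (x ** D y)).

Definition Der A : {vspace 'End(A)} :=
  set_span (fun D : 'End(A) => exists d, derivation d D).

(* The subtraction is never truncated: Der A is a subspace of End A. *)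
Definition orbit_dim A : nat := (\dim {:A} ^ 2 - \dim (Der A))%N.

End Theory.

Section DirectSum.
Variables (F : fieldType) (A B : superalgebra F).

Definition dsum_mul (x y : A * B) : A * B := (x.1 ** y.1, x.2 ** y.2).

Fact dsum_mul_bilinear : bilinear_for *:%R *:%R dsum_mul.
Proof.
by split=> u a x y; rewrite /dsum_mul /= ?linearPl ?linearPr.
Qed.

HB.instance Definition _ :=
  bilinear_isBilinear.Build F _ _ _ _ _ dsum_mul dsum_mul_bilinear.

Definition dsum_gr (i : bool) : {vspace A * B} :=
  (linfun (@fst A B) @^-1: sa_gr A i :&: linfun (@snd A B) @^-1: sa_gr B i)%VS.

Fact mem_dsum_gr i (x : A * B) :
  (x \in dsum_gr i) = (x.1 \in sa_gr A i) && (x.2 \in sa_gr B i).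
Proof. by rewrite memv_cap -!memv_preim !lfunE. Qed.

Fact dsum_span : (dsum_gr false + dsum_gr true = fullv)%VS.
Proof.
apply/vspaceP=> -[a b]; rewrite memvf.
have : a \in fullv by exact: memvf.
rewrite -sa_span => /memv_addP[a0 Aa0 [a1 Aa1 ->]].
have : b \in fullv by exact: memvf.
rewrite -sa_span => /memv_addP[b0 Bb0 [b1 Bb1 ->]].
apply/memv_addP; exists (a0, b0); first by rewrite mem_dsum_gr Aa0.
by exists (a1, b1); rewrite // mem_dsum_gr Aa1.
Qed.

Fact dsum_direct : (dsum_gr false :&: dsum_gr true = 0)%VS.
Proof.
apply/eqP; rewrite -subv0; apply/subvP=> -[a b].
rewrite memv_cap !mem_dsum_gr /= => /andP[/andP[a0 b0] /andP[a1 b1]].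
have : a \in (sa_gr A false :&: sa_gr A true)%VS by rewrite memv_cap a0.
have : b \in (sa_gr B false :&: sa_gr B true)%VS by rewrite memv_cap b0.
by rewrite !sa_direct !memv0 => /eqP-> /eqP->.
Qed.

Fact dsum_graded i j (x y : A * B) :
  x \in dsum_gr i -> y \in dsum_gr j -> dsum_mul x y \in dsum_gr (i (+) j).
Proof.
rewrite !mem_dsum_gr => /andP[xA xB] /andP[yA yB].
by rewrite !sa_graded.
Qed.

Definition dsum : superalgebra F :=
  @Superalgebra F (A * B)%type dsum_mul dsum_gr dsum_span dsum_direct dsum_graded.

End DirectSum.

Definition indecomposable (F : fieldType) (A : superalgebra F) : Prop :=
  \dim {:A} != 0%N /\
  forall B C : superalgebra F, sa_iso A (dsum B C) ->
    \dim {:B} = 0%N \/ \dim {:C} = 0%N.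

(* [table m n s] has basis b_0, ..., b_(m+n-1), where b_i is even for i < m    *)
(* and odd otherwise. An entry [(i, j, k, a)] of [s] means b_i b_j = a b_k,    *)
(* and also b_j b_i = (-1)^(|i||j|) a b_k when i and j differ; several entries *)
(* for the same (i, j) are added up, and a product without entry is zero.      *)
Section Table.
Variables (F : fieldType) (m n : nat) (s : seq (nat * nat * nat * F)).

Definition odd_index (i : nat) : bool := (m <= i)%N.

Definition well_graded : bool :=
  all (fun t => let: (i, j, k, _) := t in
         odd_index k == odd_index i (+) odd_index j) s.

Hypothesis sP : well_graded.

Definition table_coef (i j k : nat) : F :=
  \sum_(t <- s) let: (i', j', k', a) := t in
    if (i, j, k) == (i', j', k') then a
    else if (j, i, k) == (i', j', k') then (-1) ^+ (odd_index i * odd_index j) * a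
    else 0.

Definition table_mul (x y : 'rV[F]_(m + n)) : 'rV[F]_(m + n) :=
  \row_k \sum_i \sum_j x 0 i * y 0 j * table_coef i j k.

Fact table_mul_bilinear : bilinear_for *:%R *:%R table_mul.
Proof.
split=> u a x y; apply/rowP=> k; rewrite !mxE mulr_sumr -big_split;
  apply: eq_bigr => i _; rewrite mulr_sumr -big_split;
  apply: eq_bigr => j _; rewrite !mxE /=.
  by rewrite !mulrDl !mulrA.
by rewrite mulrDr mulrDl !mulrA (mulrC _ a).
Qed.

HB.instance Definition _ :=
  bilinear_isBilinear.Build F _ _ _ _ _ table_mul table_mul_bilinear.

Definition table_gr (b : bool) : {vspace 'rV[F]_(m + n)} :=
  (\sum_(i < m + n | odd_index i == b) <[delta_mx 0%R i]>)%VS.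

Fact mem_table_gr b (x : 'rV[F]_(m + n)) :
  reflect (forall i : 'I_(m + n), odd_index i != b -> x 0 i = 0) (x \in table_gr b).
Proof.
apply: (iffP memv_sumP) => [[v vP ->] i ib|x0].
  rewrite summxE big1 // => j jb; have /vlineP[a ->] := vP j jb.
  rewrite !mxE eqxx /=; case: eqP => [ij|]; last by rewrite mulr0.
  by move: ib; rewrite ij jb.
exists (fun i => x 0 i *: delta_mx 0 i) => [i _|].
  exact/memvZ/memv_line.
rewrite {1}[x]row_sum_delta [RHS]big_mkcond; apply: eq_bigr => i _.
by case: ifPn => // /x0 ->; rewrite scale0r.
Qed.

Fact table_span : (table_gr false + table_gr true = fullv)%VS.
Proof.
apply/vspaceP=> x; rewrite memvf; apply/memv_addP.
exists (\row_i (if odd_index i then 0 else x 0 i)).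
  by apply/mem_table_gr=> i; rewrite mxE; case: odd_index.
exists (\row_i (if odd_index i then x 0 i else 0)).
  by apply/mem_table_gr=> i; rewrite mxE; case: odd_index.
by apply/rowP=> i; rewrite !mxE; case: odd_index; rewrite ?addr0 ?add0r.
Qed.

Fact table_direct : (table_gr false :&: table_gr true = 0)%VS.
Proof.
apply/eqP; rewrite -subv0; apply/subvP=> x.
rewrite memv_cap => /andP[/mem_table_gr x0 /mem_table_gr x1].
rewrite memv0; apply/eqP/rowP=> i; rewrite mxE.
by case E: (odd_index i); [apply: x0 | apply: x1]; rewrite E.
Qed.

Fact table_coef0 (i j k : nat) :
  odd_index k != odd_index i (+) odd_index j -> table_coef i j k = 0.
Proof.
move=> kij; rewrite /table_coef big_seq big1 // => -[[[i' j'] k'] a] ts.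
have /eqP t0 := allP sP _ ts.
case: eqP => [[ei ej ek]|_]; first by rewrite ei ej ek t0 eqxx in kij.
case: eqP => // -[ei ej ek]; by rewrite ei ej ek t0 addbC eqxx in kij.
Qed.

Fact table_graded b c (x y : 'rV[F]_(m + n)) :
  x \in table_gr b -> y \in table_gr c -> table_mul x y \in table_gr (b (+) c).
Proof.
move=> /mem_table_gr x0 /mem_table_gr y0; apply/mem_table_gr=> k kbc.
rewrite mxE big1 // => i _; rewrite big1 // => j _.
have [ib|/x0->] := eqVneq (odd_index i) b; last by rewrite !mul0r.
have [jc|/y0->] := eqVneq (odd_index j) c; last by rewrite mulr0 mul0r.
by rewrite table_coef0 ?mulr0 // ib jc.
Qed.

Definition table : superalgebra F :=
  @Superalgebra F 'rV[F]_(m + n) table_mul table_gr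
    table_span table_direct table_graded.

End Table.

Section List.
Variable F : fieldType.

Local Notation "[ 'tbl' m , n | s ]" := (@table F m n s isT)
  (at level 0, m at level 9, n at level 9).
Local Notation half := (2^-1 : F).

Section OneOdd.
Local Notation e := 0%N.
Local Notation f := 1%N.
Definition U_1 := [tbl 1, 0 | [:: (e, e, e, 1)]].
Definition S_1_1 := [tbl 0, 1 | [::]].
Definition S_1_2 := [tbl 1, 1 | [:: (e, e, e, 1); (e, f, f, half)]].
Definition S_2_2 := [tbl 1, 1 | [:: (e, e, e, 1); (e, f, f, 1)]].
End OneOdd.

Local Notation e := 0%N.
Local Notation f1 := 1%N.
Local Notation f2 := 2%N.
Local Notation f3 := 3%N.

(* [S_k_d] stands for S_k^d, of dimension d. *)
Definition S_1_3 := [tbl 1, 2 | [:: (e, f1, f2, 1); (f1, f2, e, 1)]].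
Definition S_2_3 := [tbl 1, 2 | [:: (f1, f2, e, 1)]].
Definition S_3_3 := [tbl 1, 2 | [:: (e, f1, f2, 1)]].
Definition S_4_3 := [tbl 1, 2 |
  [:: (e, e, e, 1); (e, f1, f1, 1); (e, f2, f2, half)]].
Definition S_5_3 := [tbl 1, 2 |
  [:: (e, e, e, 1); (e, f1, f1, half); (e, f2, f2, half)]].
Definition S_6_3 := [tbl 1, 2 |
  [:: (e, e, e, 1); (e, f1, f1, 1); (e, f2, f2, 1)]].
Definition S_7_3 := [tbl 1, 2 |
  [:: (e, e, e, 1); (e, f1, f1, half); (e, f2, f2, half); (f1, f2, e, 1)]].
Definition S_8_3 := [tbl 1, 2 |
  [:: (e, e, e, 1); (e, f1, f1, 1); (e, f2, f2, 1); (f1, f2, e, 1)]].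

Definition J_1 := [tbl 1, 3 | [:: (f1, f2, e, 1)]].
Definition J_2 := [tbl 1, 3 | [:: (e, f1, f2, 1)]].
Definition J_3 := [tbl 1, 3 | [:: (e, f1, f2, 1); (f1, f2, e, 1)]].
Definition J_4 := [tbl 1, 3 | [:: (e, f1, f2, 1); (f1, f3, e, 1)]].
Definition J_5 := [tbl 1, 3 | [:: (e, f1, f2, 1); (f2, f3, e, 1)]].
Definition J_6 := [tbl 1, 3 | [:: (e, f1, f2, 1); (e, f2, f3, 1)]].
Definition J_7 := [tbl 1, 3 | [:: (e, e, e, 1)]].
Definition J_8 := [tbl 1, 3 | [:: (e, e, e, 1); (e, f3, f3, half)]].
Definition J_9 := [tbl 1, 3 | [:: (e, e, e, 1); (e, f3, f3, 1)]].
Definition J_10 := [tbl 1, 3 |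
  [:: (e, e, e, 1); (e, f2, f2, half); (e, f3, f3, half)]].
Definition J_11 := [tbl 1, 3 |
  [:: (e, e, e, 1); (e, f2, f2, half); (e, f3, f3, half); (f2, f3, e, 1)]].
Definition J_12 := [tbl 1, 3 |
  [:: (e, e, e, 1); (e, f2, f2, half); (e, f3, f3, 1)]].
Definition J_13 := [tbl 1, 3 |
  [:: (e, e, e, 1); (e, f2, f2, 1); (e, f3, f3, 1)]].
Definition J_14 := [tbl 1, 3 |
  [:: (e, e, e, 1); (e, f2, f2, 1); (e, f3, f3, 1); (f2, f3, e, 1)]].
Definition J_15 := [tbl 1, 3 |
  [:: (e, e, e, 1); (e, f1, f1, half); (e, f2, f2, half); (e, f3, f3, half)]].
Definition J_16 := [tbl 1, 3 |
  [:: (e, e, e, 1); (e, f1, f1, half); (e, f2, f2, half); (e, f3, f3, 1)]].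
Definition J_17 := [tbl 1, 3 |
  [:: (e, e, e, 1); (e, f1, f1, half); (e, f2, f2, 1); (e, f3, f3, 1)]].
Definition J_18 := [tbl 1, 3 |
  [:: (e, e, e, 1); (e, f1, f1, 1); (e, f2, f2, 1); (e, f3, f3, 1)]].
Definition J_19 := [tbl 1, 3 |
  [:: (e, e, e, 1); (e, f1, f1, 1); (e, f2, f2, 1); (e, f3, f3, 1);
      (f1, f2, e, 1)]].

(* The ordinal [i] stands for the (i + 1)-st algebra of the list. *)
Definition J_ (i : 'I_19) : superalgebra F :=
  match val i with
  | 0 => J_1
  | 1 => J_2
  | 2 => J_3
  | 3 => J_4
  | 4 => J_5
  | 5 => J_6
  | 6 => J_7
  | 7 => J_8
  | 8 => J_9
  | 9 => J_10
  | 10 => J_11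
  | 11 => J_12
  | 12 => J_13
  | 13 => J_14
  | 14 => J_15
  | 15 => J_16
  | 16 => J_17
  | 17 => J_18
  | _ => J_19
  end%N.

End List.

(* Main.v *)
Require Import Defs.
From HB Require Import structures.
From mathcomp Require Import all_boot all_order all_algebra.
From mathcomp Require Import boolp reals complex ring.

(* A superalgebra of type (1, 3) consists of an even line spanned by e, the     *)
(* operator L = (e ** _) on the odd part and the alternating form w with       *)
(* u ** v = w(u, v) e. If e ** e = la e, the Jordan identity yields            *)
(*   la^2 L + 2 L^3 = 3 la L^2.                                                *)
(* If la = 0, then L is nilpotent, and the algebra is determined by the rank   *)
(* of L and the position of the radical of w with respect to the image and the *)
(* kernel of L; moreover w = 0 when L has rank 2. If la <> 0, one may take     *)
(* la = 1; then L is diagonalizable with eigenvalues among 0, 1/2, 1, and the  *)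
(* other instances of the Jordan identity force w to vanish unless exactly one *)
(* nonzero eigenvalue occurs, and, if this eigenvalue is 1/2, unless its       *)
(* multiplicity is at most 2.                                                  *)
(*                                                                             *)
(* For a given table everything is homogeneous in the structure constants,     *)
(* whose doubles are integers here. Hence the Jordan identity, a basis of the  *)
(* derivations and the invariants that separate the 19 algebras (the orbit     *)
(* dimension and the validity of a few multilinear identities) are obtained by *)
(* computing with integers. An algebra with a one-dimensional even part is     *)
(* indecomposable as soon as its odd annihilator consists of products.         *)

Set Implicit Arguments.
Unset Strict Implicit.
Unset Printing Implicit Defensive.

Import GRing.Theory Num.Theory.
Local Open Scope ring_scope.

(** * Isomorphisms *)

(** Completeness: [odd_basis_iso] reduces an isomorphism with a listed algebra to a suitable basis
    of the odd part. Such a basis comes from four instances of the Jordan identity: [jordan_eeev]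
    restricts L, while [jordan_ueve], [jordan_uvwe] and [jordan_uvew] restrict w. For la = 0, the
    cases L = 0, L^2 = 0 <> L and L^2 <> 0 lead to J_1, to J_2, ..., J_5 and to J_6
    ([classify_zero], [classify_square_zero], [classify_nilpotent]). For la = 1, [eigenbasis] splits
    the odd part into eigenspaces of L, and [classify_idempotent] treats the ten triples of
    eigenvalues, each of which gives one or two algebras. The zero algebra is excluded by
    [nonzero_product]. A square root is extracted only once, to normalise J_3.

    Irredundancy ([J_iso_inj]): the dimension of the derivation algebra and five boolean invariants
    separate the 19 algebras. The derivations solve a linear system with integer coefficients;
    [iDer_basisP] certifies an explicit basis by exact elimination. For J_2 and J_3 the derivation
    algebras have dimensions 9 and 6, so the orbit dimensions proved are 7 and 10, not the 6 and 9
    of the statement in words.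

    Decompositions are relabellings of basis vectors ([table_decomposition]), and indecomposability
    follows from [indecomposableI]. *)

Section Isomorphisms.
Variable F : fieldType.
Implicit Types A B C : superalgebra F.

Lemma sa_dim A : (\dim (sa_gr A false) + \dim (sa_gr A true))%N = \dim {:A}.
Proof. by rewrite -dimv_disjoint_sum ?sa_direct // sa_span. Qed.

Lemma sa_gr_cap A (x : A) : x \in sa_gr A false -> x \in sa_gr A true -> x = 0.
Proof.
move=> x0 x1; apply/eqP; rewrite -memv0 -(sa_direct A).
by rewrite memv_cap x0 x1.
Qed.

(** An injective map between spaces of equal dimension is onto. The dimension inequalities for the
    even and the odd part have equal sums on both sides, so they are equalities and the graded parts
    correspond exactly. *)
Lemma sa_isoI A B (f : 'Hom(A, B)) :
    (forall x, f x = 0 -> x = 0) -> \dim {:A} = \dim {:B} ->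
    (forall x y, f (x ** y) = f x ** f y) ->
    (forall i x, x \in sa_gr A i -> f x \in sa_gr B i) ->
  sa_iso A B.
Proof.
move=> f0 dAB fM fgr.
have kf : lker f == 0%VS.
  rewrite -subv0; apply/subvP=> x; rewrite memv_ker memv0 => /eqP fx.
  exact/eqP/f0.
have dimf U : \dim (f @: U) = \dim U.
  by rewrite limg_dim_eq // (eqP kf) capv0.
have fi : limg f = fullv.
  by apply/eqP; rewrite eqEdim subvf dimf dAB leqnn.
exists f; split=> //.
  exists (f^-1)%VF; first exact: lker0_lfunK.
  by move=> y; apply: limg_lfunVK; rewrite fi memvf.
have sub i : (f @: sa_gr A i <= sa_gr B i)%VS.
  by apply/subvP=> _ /memv_imgP[x Ax ->]; exact: fgr.
have le i : (\dim (sa_gr A i) <= \dim (sa_gr B i))%N.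
  by rewrite -(dimf (sa_gr A i)) dimvS.
move=> i; apply/eqP; rewrite eqEdim sub dimf /=.
have := le (~~ i); have := sa_dim A; rewrite dAB -(sa_dim B).
case: i => /= e l.
  by rewrite -(leq_add2l (\dim (sa_gr B false))) -e leq_add2r.
by rewrite -(leq_add2r (\dim (sa_gr B true))) -e leq_add2l.
Qed.

(** [sa_iso] only provides a set-theoretic inverse; the linear inverse also respects products and
    degrees, so isomorphisms can be reversed and composed. *)
Lemma sa_isoE A B : sa_iso A B -> exists f : 'Hom(A, B), exists g : 'Hom(B, A),
  [/\ cancel f g, cancel g f,
      forall x y, f (x ** y) = f x ** f y,
      forall x y, g (x ** y) = g x ** g y
    & forall i, (forall x, x \in sa_gr A i -> f x \in sa_gr B i) /\
                (forall x, x \in sa_gr B i -> g x \in sa_gr A i)].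
Proof.
case=> f [[g' fK gK] fM fgr].
have kf : lker f == 0%VS.
  rewrite -subv0; apply/subvP=> x; rewrite memv_ker memv0 => /eqP fx.
  by rewrite -(fK x) fx -(linear0 f) fK.
have fVK : cancel f (f^-1)%VF by exact: lker0_lfunK.
have VfK : cancel (f^-1)%VF f.
  by move=> y; rewrite -[y]gK fVK.
exists f, (f^-1)%VF; split=> //.
  by move=> x y; apply: (can_inj fVK); rewrite fM !VfK.
move=> i; split=> [x Ax|x]; rewrite -fgr ?memv_img //.
by case/memv_imgP=> z Az ->; rewrite fVK.
Qed.

Lemma sa_iso_sym A B : sa_iso A B -> sa_iso B A.
Proof.
move=> /sa_isoE[f [g [fK gK fM gM gr]]].
have dAB : \dim {:B} = \dim {:A}.
  apply/eqP; rewrite eqn_leq; apply/andP; split.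
    have -> : fullv = limg f.
      by apply/eqP; rewrite eqEsubv subvf andbT; apply/subvP=> y _;
        rewrite -(gK y) memv_img ?memvf.
    by rewrite -(limg_ker_dim f) leq_addl.
  have -> : fullv = limg g.
    by apply/eqP; rewrite eqEsubv subvf andbT; apply/subvP=> y _;
      rewrite -(fK y) memv_img ?memvf.
  by rewrite -(limg_ker_dim g) leq_addl.
apply: (sa_isoI (f := g)) => // [x gx|i x]; last exact: (gr i).2.
by rewrite -(gK x) gx linear0.
Qed.

Lemma sa_iso_dim A B : sa_iso A B -> \dim {:A} = \dim {:B}.
Proof.
have le A' B' : sa_iso A' B' -> (\dim {:B'} <= \dim {:A'})%N.
  move=> /sa_isoE[f [g [fK gK _ _ _]]].
  have -> : {:B'}%VS = limg f.
    by apply/eqP; rewrite eqEsubv subvf andbT; apply/subvP=> y _;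
      rewrite -(gK y) memv_img ?memvf.
  by rewrite -(limg_ker_dim f) leq_addl.
by move=> AB; apply/eqP; rewrite eqn_leq !le //; exact: sa_iso_sym.
Qed.

Lemma sa_iso_trans A B C : sa_iso A B -> sa_iso B C -> sa_iso A C.
Proof.
move=> AB BC; have dAC := etrans (sa_iso_dim AB) (sa_iso_dim BC).
have [f [f' [fK _ fM _ fgr]]] := sa_isoE AB.
have [g [g' [gK _ gM _ ggr]]] := sa_isoE BC.
apply: (sa_isoI (f := (g \o f)%VF)) => // [x|x y|i x Ax]; rewrite ?comp_lfunE.
- by move=> gfx; rewrite -(fK x) -(gK (f x)) gfx !linear0.
- by rewrite fM gM.
- exact/(ggr i).1/(fgr i).1.
Qed.

Lemma sa_iso_refl A : sa_iso A A.
Proof.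
by apply: (sa_isoI (f := \1%VF)) => // [x|x y|i x]; rewrite !id_lfunE.
Qed.

Lemma dim_pair (V W : vectType F) : \dim {: (V * W)%type} = (\dim {:V} + \dim {:W})%N.
Proof. by rewrite !dimvf. Qed.

Lemma dsum_isor A B C : sa_iso B C -> sa_iso (dsum A B) (dsum A C).
Proof.
move=> BC; have dBC := sa_iso_dim BC.
have [f [f' [fK _ fM _ fgr]]] := sa_isoE BC.
pose h (x : A * B) : A * C := (x.1, f x.2).
have h_lin : linear h by move=> a x y; rewrite /h /= linearP.
pose hL : {linear _ -> _} := HB.pack h (GRing.isLinear.Build _ _ _ _ h h_lin).
have hE x : linfun hL x = (x.1, f x.2) by rewrite lfunE.
apply: (sa_isoI (A := dsum A B) (B := dsum A C) (f := linfun hL)).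
- by move=> [a b]; rewrite hE /= => -[-> fb]; rewrite -(fK b) fb linear0.
- by rewrite !dim_pair dBC.
- by move=> [a b] [c d]; rewrite !hE /= fM.
- move=> i [a b]; rewrite hE /= !mem_dsum_gr /= => /andP[-> /=].
  exact: (fgr i).1.
Qed.

End Isomorphisms.

(** * Invariance of the orbit dimension under isomorphism *)

Section DerivationsIso.
Variable F : fieldType.
Implicit Types A B : superalgebra F.

(** Conjugation by the isomorphism is linear and injective and preserves homogeneous derivations. As
    [Der] is a span, it suffices to test these generators. *)
Lemma sa_iso_dim_Der_le A B : sa_iso A B -> (\dim (Der A) <= \dim (Der B))%N.
Proof.
move=> /sa_isoE[f [g [fK gK fM gM fgr]]].
pose h (D : 'End(A)) : 'End(B) := (f \o D \o g)%VF.
have h_lin : linear h.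
  by move=> a D D'; apply/lfunP=> x; rewrite /h !(comp_lfunE, add_lfunE, scale_lfunE) linearP.
pose hL : {linear _ -> _} := HB.pack h (GRing.isLinear.Build _ _ _ _ h h_lin).
have hE D x : linfun hL D x = f (D (g x)) by rewrite lfunE /= /h !comp_lfunE.
have kh : (Der A :&: lker (linfun hL) = 0)%VS.
  apply/eqP; rewrite -subv0; apply/subvP=> D; rewrite memv_cap memv_ker => /andP[_ /eqP hD0].
  rewrite memv0; apply/eqP/lfunP=> x; rewrite lfunE /=.
  have := hE D (f x); rewrite fK hD0 lfunE /= => /esym e0.
  by rewrite -(fK (D x)) e0 linear0.
rewrite -(limg_dim_eq kh) dimvS //.
have [_ minA] := set_spanP (fun D : 'End(A) => exists d, derivation d D).
have [inB _] := set_spanP (fun D : 'End(B) => exists d, derivation d D).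
apply: subv_trans (_ : (linfun hL @: (linfun hL @^-1: Der B))%VS <= _)%VS.
  apply/limgS/minA => D [d [Dgr Dd]]; rewrite -memv_preim; apply: inB; exists d.
  split=> [i|i x y Bx]; last first.
    by rewrite !hE gM (Dd i) ?(fgr i).2 // linearD linearZ /= !fM !gK.
  apply/subvP=> _ /memv_imgP[x Bx ->]; rewrite hE (fgr _).1 //.
  by apply: (subvP (Dgr i)); rewrite memv_img // (fgr i).2.
by apply/subvP=> _ /memv_imgP[D DB ->]; rewrite memv_preim.
Qed.

Lemma sa_iso_orbit_dim A B : sa_iso A B -> orbit_dim A = orbit_dim B.
Proof.
move=> AB; rewrite /orbit_dim (sa_iso_dim AB); congr (_ - _)%N.
by apply/eqP; rewrite eqn_leq !sa_iso_dim_Der_le //; exact: sa_iso_sym.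
Qed.

End DerivationsIso.

(** * Algebras given by multiplication tables *)

Section Tables.
Variable F : fieldType.

Lemma bilin_suml (A : superalgebra F) I (r : seq I) (P : pred I) (E : I -> A) y :
  (\sum_(i <- r | P i) E i) ** y = \sum_(i <- r | P i) E i ** y.
Proof.
by apply: (big_morph (fun x => x ** y)) => [u v|]; rewrite ?linearDl ?linear0l.
Qed.

Lemma bilin_sumr (A : superalgebra F) I (r : seq I) (P : pred I) (E : I -> A) x :
  x ** (\sum_(i <- r | P i) E i) = \sum_(i <- r | P i) x ** E i.
Proof. exact: linear_sumr. Qed.

Variables (m n : nat) (s : seq (nat * nat * nat * F)) (sP : well_graded m s).
Local Notation T := (table n sP).
Local Notation c := (table_coef m s).

Lemma delta_gr (i : 'I_(m + n)) :
  (delta_mx 0 i : T) \in sa_gr T (odd_index m i).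
Proof.
apply/mem_table_gr=> j; rewrite mxE /=.
by have [->|] := eqVneq j i; rewrite ?eqxx.
Qed.

Lemma table_mulE (x y : T) :
  x ** y = \sum_i \sum_j (x 0 i * y 0 j) *: (\row_k c i j k : T).
Proof.
apply/rowP=> k; rewrite mxE summxE; apply: eq_bigr => i _.
by rewrite summxE; apply: eq_bigr => j _; rewrite !mxE.
Qed.

Lemma delta_mul (i j : 'I_(m + n)) :
  (delta_mx 0 i : T) ** delta_mx 0 j = \row_k c i j k.
Proof.
rewrite table_mulE (bigD1 i) //= (bigD1 j) //= !mxE !eqxx mul1r scale1r.
rewrite !big1 ?addr0 // => [k ki|k kj].
  rewrite big1 // => l _; rewrite !mxE eqxx (negPf ki) /=.
  by rewrite mul0r scale0r.
by rewrite !mxE !eqxx (negPf kj) /= mulr0 scale0r.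
Qed.

Lemma table_dim : \dim {:T} = (m + n)%N.
Proof. by rewrite dimvf; exact: mul1n. Qed.

(** The spanning basis vectors bound both dimensions from above; the dimensions add up to m + n, so
    both bounds are attained. *)
Lemma table_dim_gr : \dim (sa_gr T false) = m /\ \dim (sa_gr T true) = n.
Proof.
have le b : (\dim (sa_gr T b) <= \sum_(i < m + n | odd_index m i == b) 1)%N.
  apply: leq_trans (dimv_leq_sum _ _ _) _; apply: leq_sum => i _.
  by rewrite dim_vline leq_b1.
have tot := sa_dim T; rewrite table_dim in tot.
have n0 : (\sum_(i < m + n | odd_index m i == false) 1 = m)%N.
  rewrite big_split_ord /= [X in (X + _)%N](eq_bigl xpredT) => [|i].
    rewrite sum1_card card_ord big_pred0 ?addn0 // => i.
    by rewrite /odd_index /= leq_addr.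
  by rewrite /odd_index /= leqNgt ltn_ord.
have n1 : (\sum_(i < m + n | odd_index m i == true) 1 = n)%N.
  rewrite big_split_ord /= addnC [X in (X + _)%N](eq_bigl xpredT) => [|i].
    rewrite sum1_card card_ord big_pred0 ?addn0 // => i.
    by rewrite /odd_index /= leqNgt ltn_ord.
  by rewrite /odd_index /= leq_addr.
have := le false; have := le true; rewrite n0 n1 => l1 l0.
split; apply/eqP; rewrite eqn_leq ?l0 ?l1 /=.
  by rewrite -(leq_add2r n) -{1}tot leq_add2l.
by rewrite -(leq_add2l m) -{1}tot leq_add2r.
Qed.

Lemma table_iso (A : superalgebra F) (b : 'I_(m + n) -> A) :
    \dim {:A} = (m + n)%N ->
    (forall x : 'I_(m + n) -> F, \sum_i x i *: b i = 0 -> forall i, x i = 0) ->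
    (forall i, b i \in sa_gr A (odd_index m i)) ->
    (forall i j, b i ** b j = \sum_(k < m + n) c i j k *: b k) ->
  sa_iso T A.
Proof.
move=> dA bfree bgr bM.
pose h (x : T) : A := \sum_i x 0 i *: b i.
have h_lin : linear h.
  move=> a x y; rewrite /h scaler_sumr -big_split; apply: eq_bigr => i _ /=.
  by rewrite !mxE scalerDl scalerA.
pose hL : {linear _ -> _} := HB.pack h (GRing.isLinear.Build _ _ _ _ h h_lin).
have hE x : linfun hL x = h x by rewrite lfunE.
apply: (sa_isoI (f := linfun hL)) => [x|||i x]; rewrite ?hE.
- by move=> /bfree x0; apply/rowP=> i; rewrite x0 mxE.
- by rewrite table_dim dA.
- move=> x y; rewrite !hE {2 3}/h bilin_suml table_mulE.
  rewrite -hE linear_sum; apply: eq_bigr => i _.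
  rewrite bilin_sumr linear_sum; apply: eq_bigr => j _.
  rewrite linearZ /= hE linearZl_LR linearZr_LR scalerA bM; congr (_ *: _).
  by apply: eq_bigr => k _; rewrite mxE.
move=> /mem_table_gr x0; apply: rpred_sum => j _.
have [<-|/x0->] := eqVneq (odd_index m j) i; last by rewrite scale0r rpred0.
exact/rpredZ/bgr.
Qed.

End Tables.

(** * Decompositions, invariants and homogeneous bases *)

Section Bilinear.
Variables (F : fieldType) (A : superalgebra F).
Implicit Types (a : F) (x y z : A).

Lemma sa_mul0l y : (0 : A) ** y = 0. Proof. exact: linear0l. Qed.
Lemma sa_mul0r x : x ** (0 : A) = 0. Proof. exact: linear0r. Qed.
Lemma sa_mulPl a x y z : (a *: x + y) ** z = a *: (x ** z) + y ** z.
Proof. exact: linearPl. Qed.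
Lemma sa_mulPr a x y z : x ** (a *: y + z) = a *: (x ** y) + x ** z.
Proof. exact: linearPr. Qed.
Lemma sa_mulZl a x y : (a *: x) ** y = a *: (x ** y).
Proof. exact: linearZl_LR. Qed.
Lemma sa_mulZr a x y : x ** (a *: y) = a *: (x ** y).
Proof. exact: linearZr_LR. Qed.
Lemma sa_mulDl x y z : (x + y) ** z = x ** z + y ** z.
Proof. exact: linearDl. Qed.
Lemma sa_mulDr x y z : x ** (y + z) = x ** y + x ** z.
Proof. exact: linearDr. Qed.

End Bilinear.

(** * Direct sums and indecomposability *)

Section Indecomposable.
Variable F : fieldType.
Implicit Types A B C : superalgebra F.

Lemma dsum_mulE B C (x y : dsum B C) : x ** y = (x.1 ** y.1, x.2 ** y.2).
Proof. by []. Qed.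

(** A purely odd C has zero product. So everything annihilates (0, w), whose image in A is therefore
    a product; the second coordinate of that product lies in C ** C = 0, whence w = 0. *)
Lemma trivial_summand A B C (f : 'Hom(A, dsum B C)) (g : 'Hom(dsum B C, A)) :
    cancel f g -> cancel g f ->
    (forall x y, f (x ** y) = f x ** f y) ->
    (forall x y, g (x ** y) = g x ** g y) ->
    (forall i x, x \in sa_gr (dsum B C) i -> g x \in sa_gr A i) ->
    (forall y : A, y \in sa_gr A true -> (forall x, x ** y = 0) ->
       exists x z : A, y = x ** z) ->
  (sa_gr C false = 0)%VS -> \dim {:C} = 0%N.
Proof.
move=> fK gK fM gM ggr annP C0.
have odd_C (x : C) : x \in sa_gr C true.
  have : x \in fullv by exact: memvf.
  by rewrite -sa_span C0 add0v.
have C_mul (x y : C) : x ** y = 0.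
  apply/eqP; rewrite -memv0 -C0.
  by apply: (sa_graded (odd_C x) (odd_C y)).
apply/eqP; rewrite dimv_eq0 -subv0; apply/subvP=> w _; rewrite memv0.
have [||x [z e]] := annP (g (0, w)).
- by apply: ggr; rewrite mem_dsum_gr rpred0 odd_C.
- move=> x; rewrite -[x]fK -gM.
  have -> : (f x : dsum B C) ** ((0, w) : dsum B C) = 0.
    by rewrite dsum_mulE linear0r C_mul.
  exact: linear0.
have := congr1 (fun u => (f u).2) e; rewrite fM gK /= => ->.
by rewrite C_mul.
Qed.

Definition dsum_swap B C (x : dsum B C) : dsum C B := (x.2, x.1).

Lemma dsumC_iso B C : sa_iso (dsum B C) (dsum C B).
Proof.
have h_lin : linear (@dsum_swap B C) by [].
pose hL : {linear _ -> _} :=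
  HB.pack (@dsum_swap B C) (GRing.isLinear.Build _ _ _ _ _ h_lin).
have hE x : linfun hL x = (x.2, x.1) by rewrite lfunE.
apply: (sa_isoI (f := linfun hL)) => [[b c]|||i [b c]]; rewrite ?hE /=.
- by move=> -[-> ->].
- by rewrite !dim_pair addnC.
- by move=> x y; rewrite !hE.
- by rewrite !mem_dsum_gr /= andbC.
Qed.

Lemma sa_iso_dim_gr A B i : sa_iso A B -> \dim (sa_gr A i) = \dim (sa_gr B i).
Proof.
case=> f [fbij _ <-]; rewrite limg_dim_eq //.
apply/eqP; rewrite -subv0; apply/subvP=> x; rewrite memv_cap memv_ker memv0.
by case/andP=> _ /eqP fx; apply/eqP/(bij_inj fbij); rewrite fx linear0.
Qed.

Lemma dsum_dim_gr B C i :
  \dim (sa_gr (dsum B C) i) = (\dim (sa_gr B i) + \dim (sa_gr C i))%N.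
Proof.
pose p1 := linfun (@fst B C); pose p2 := linfun (@snd B C).
rewrite -(limg_ker_dim p1) addnC; congr (_ + _)%N.
  congr (\dim _); apply/vspaceP=> b; apply/memv_imgP/idP => [[x]|Bb].
    by rewrite mem_dsum_gr lfunE => /andP[? _] ->.
  by exists (b, 0); rewrite ?lfunE // mem_dsum_gr Bb rpred0.
rewrite -(limg_dim_eq (f := p2)).
  congr (\dim _); apply/vspaceP=> c; apply/memv_imgP/idP => [[x]|Cc].
    by rewrite memv_cap mem_dsum_gr [p2 x]lfunE => /andP[/andP[_ ?] _] ->.
  exists (0, c); rewrite ?[p2 _]lfunE //.
  by rewrite memv_cap mem_dsum_gr memv_ker [p1 _]lfunE rpred0 Cc /=.
apply/eqP; rewrite -subv0; apply/subvP=> -[b c].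
rewrite !memv_cap !memv_ker [p1 _]lfunE [p2 _]lfunE memv0 /=.
by case/andP=> /andP[_ /eqP->] /eqP->.
Qed.

(* One of two summands B and C of A, say C, has no even part; then A           *)
(* annihilates C, so C lies in A ** A = B ** B, hence C = 0.                   *)
Lemma indecomposableI A :
    \dim (sa_gr A false) = 1%N ->
    (forall y : A, y \in sa_gr A true -> (forall x, x ** y = 0) ->
       exists x z : A, y = x ** z) ->
  indecomposable A.
Proof.
move=> A0 annP; split=> [|B C AB]; first by rewrite -sa_dim A0.
have := dsum_dim_gr B C false; rewrite -(sa_iso_dim_gr _ AB) A0.
case E: (\dim (sa_gr C false)) => [|k].
  have [f [g [fK gK fM gM gr]]] := sa_isoE AB.
  move=> _; right; apply: (trivial_summand fK gK fM gM _ annP) => [i x|].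
    exact: (gr i).2.
  by apply/eqP; rewrite -dimv_eq0 E.
(* Now B has no even part, so the summands are exchanged. *)
have [f [g [fK gK fM gM gr]]] := sa_isoE (sa_iso_trans AB (dsumC_iso B C)).
rewrite addnS => -[/esym/eqP]; rewrite addn_eq0 => /andP[B0 _].
left; apply: (trivial_summand fK gK fM gM _ annP) => [i x|].
  exact: (gr i).2.
by apply/eqP; rewrite -dimv_eq0.
Qed.

Lemma indecomposable_dim1 A : \dim {:A} = 1%N -> indecomposable A.
Proof.
move=> A1; split=> [|B C /sa_iso_dim]; rewrite A1 // dim_pair.
by case: (\dim {:B}) => [|[|?]]; case: (\dim {:C}) => [|?] //; [left|right].
Qed.

End Indecomposable.

(** * Boolean invariants *)

Section Invariants.
Variable F : fieldType.
Implicit Types A B : superalgebra F.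

Definition product_nontriv A (i j : bool) : Prop :=
  exists x y : A, [/\ x \in sa_gr A i, y \in sa_gr A j & x ** y != 0].

(** If e is idempotent and e ** y = t y with y nonzero, equality at x = x' = e means k t^2 = t.
    Among the eigenvalues 0, 1/2 and 1, k = 1 detects 1/2 and k = 2 detects 1. *)
Definition action_nontriv A (k : nat) : Prop :=
  exists x x' y : A, [/\ x \in sa_gr A false, x' \in sa_gr A false,
    y \in sa_gr A true & x ** (x' ** y) *+ k != (x ** x') ** y].

Lemma sa_iso_product_nontriv A B i j :
  sa_iso A B -> product_nontriv A i j -> product_nontriv B i j.
Proof.
move=> /sa_isoE[f [g [fK _ fM _ gr]]] [x [y [xi yj xy]]].
exists (f x), (f y); split; try exact: (gr _).1.
by apply: contra xy; rewrite -(inj_eq (can_inj fK)) linear0 fM.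
Qed.

Lemma sa_iso_action_nontriv A B k :
  sa_iso A B -> action_nontriv A k -> action_nontriv B k.
Proof.
move=> /sa_isoE[f [g [fK _ fM _ gr]]] [x [x' [y [x0 x'0 y1 xy]]]].
exists (f x), (f x'), (f y); split; try exact: (gr _).1.
by apply: contra xy => /eqP; rewrite -!fM -linearMn => /(can_inj fK)->.
Qed.

End Invariants.

(** * Multilinear identities on homogeneous generators *)

Section HomogeneousSpan.
Variable F : fieldType.
Implicit Type A : superalgebra F.

Definition jordan_at A (i j k l : bool) (x y z t : A) :=
    ((x ** y) ** z) ** t
      + (-1) ^+ (j * k + j * l + k * l) *: (((x ** t) ** z) ** y)
      + (-1) ^+ (i * j + i * k + i * l + k * l) *: (((y ** t) ** z) ** x)
    = (x ** y) ** (z ** t)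
      + (-1) ^+ (l * (j + k)) *: ((x ** t) ** (y ** z))
      + (-1) ^+ (j * k) *: ((x ** z) ** (y ** t)).

(** Both sides of the Jordan identity are signed sums of three products; this extracts a linear
    combination from all three at once. *)
Let comb3 (V : lmodType F) a s1 s2 (A1 B1 A2 B2 A3 B3 : V) :
  (a *: A1 + B1) + s1 *: (a *: A2 + B2) + s2 *: (a *: A3 + B3)
  = a *: (A1 + s1 *: A2 + s2 *: A3) + (B1 + s1 *: B2 + s2 *: B3).
Proof.
rewrite !scalerDr !scalerA [s1 * a]mulrC [s2 * a]mulrC.
by rewrite [X in X + _ = _]addrACA [LHS]addrACA.
Qed.

(** Spanning is stated as an induction principle, so that a multilinear identity can be reduced to
    generators one argument at a time. *)
Definition homogeneous_span A I (od : I -> bool) (d : I -> A) : Prop :=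
  forall (b : bool) (P : A -> Prop),
    P 0 -> (forall a x y, P x -> P y -> P (a *: x + y)) ->
    (forall i, od i = b -> P (d i)) ->
  forall x, x \in sa_gr A b -> P x.

Lemma jordan_homogeneous_span A I (od : I -> bool) (d : I -> A) :
    homogeneous_span od d ->
    (forall i j k l,
       jordan_at (od i) (od j) (od k) (od l) (d i) (d j) (d k) (d l)) ->
  jordan_identity A.
Proof.
have P0 := (@sa_mul0l, @sa_mul0r, scaler0, addr0).
have PD := (@sa_mulPl, @sa_mulPr, @comb3).
move=> ind J i j k l x y z t.
suff : forall x, x \in sa_gr A i -> forall y, y \in sa_gr A j ->
    forall z, z \in sa_gr A k -> forall t, t \in sa_gr A l ->
    jordan_at i j k l x y z t by move=> H *; exact: H.
apply: (ind) => [||i' <-]; rewrite /jordan_at.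
- by move=> *; rewrite !P0.
- by move=> a x1 x2 H1 H2 *; rewrite !PD H1 ?H2.
apply: (ind) => [||j' <-].
- by move=> *; rewrite !P0.
- by move=> a x1 x2 H1 H2 *; rewrite !PD H1 ?H2.
apply: (ind) => [||k' <-].
- by move=> *; rewrite !P0.
- by move=> a x1 x2 H1 H2 *; rewrite !PD H1 ?H2.
apply: (ind) => [||l' <-].
- by move=> *; rewrite !P0.
- by move=> a x1 x2 H1 H2 *; rewrite !PD H1 ?H2.
exact: J.
Qed.

Lemma supercommutative_homogeneous_span A I (od : I -> bool) (d : I -> A) :
    homogeneous_span od d ->
    (forall i j, d i ** d j = (-1) ^+ (od i * od j) *: (d j ** d i)) ->
  supercommutative A.
Proof.
move=> ind C i j x y.
suff : forall x, x \in sa_gr A i -> forall y, y \in sa_gr A j ->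
    x ** y = (-1) ^+ (i * j) *: (y ** x) by move=> H *; exact: H.
apply: (ind) => [y' _|a x1 x2 H1 H2 y' jy|i' <-].
- by rewrite sa_mul0l sa_mul0r scaler0.
- by rewrite sa_mulPl sa_mulPr H1 // H2 // scalerDr !scalerA mulrC.
apply: (ind) => [|a x1 x2 H1 H2|j' <-].
- by rewrite sa_mul0l sa_mul0r scaler0.
- by rewrite sa_mulPl sa_mulPr H1 H2 scalerDr !scalerA mulrC.
exact: C.
Qed.

Lemma product_triv_homogeneous_span A I (od : I -> bool) (d : I -> A) i j :
    homogeneous_span od d ->
    (forall i' j', od i' = i -> od j' = j -> d i' ** d j' = 0) ->
  ~ product_nontriv A i j.
Proof.
move=> ind C [x [y [xi yj /eqP[]]]].
suff : forall x, x \in sa_gr A i -> forall y, y \in sa_gr A j ->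
    x ** y = 0 by move=> H *; exact: H.
apply: (ind) => [y' _|a x1 x2 H1 H2 y' jy|i' ii'].
- by rewrite sa_mul0l.
- by rewrite sa_mulPl H1 // H2 // scaler0 addr0.
apply: (ind) => [|a x1 x2 H1 H2|j' jj'].
- by rewrite sa_mul0r.
- by rewrite sa_mulPr H1 H2 scaler0 addr0.
exact: C.
Qed.

Lemma action_triv_homogeneous_span A I (od : I -> bool) (d : I -> A) k :
    homogeneous_span od d ->
    (forall i i' j, od i = false -> od i' = false -> od j = true ->
       d i ** (d i' ** d j) *+ k = (d i ** d i') ** d j) ->
  ~ action_nontriv A k.
Proof.
move=> ind C [x [x' [y [xi xi' yj /eqP[]]]]].
suff : forall x, x \in sa_gr A false -> forall x', x' \in sa_gr A false ->
    forall y, y \in sa_gr A true -> x ** (x' ** y) *+ k = (x ** x') ** y.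
  by move=> H *; exact: H.
have P0 := (@sa_mul0l, @sa_mul0r, mul0rn).
apply: (ind) => [y' _ y'' _|a x1 x2 H1 H2 y' jy y'' jy'|i1 ii1].
- by rewrite !P0.
- by rewrite !sa_mulPl mulrnDl scalerMnr H1 // H2.
apply: (ind) => [y'' _|a x1 x2 H1 H2 y' jy|i2 ii2].
- by rewrite !P0.
- by rewrite !(sa_mulPl, sa_mulPr) mulrnDl scalerMnr H1 // H2.
apply: (ind) => [|a x1 x2 H1 H2|j' jj'].
- by rewrite !P0.
- by rewrite !(sa_mulPl, sa_mulPr) mulrnDl scalerMnr H1 // H2.
exact: C.
Qed.

End HomogeneousSpan.

Section BasisExtension.
Variables (F : fieldType) (m n : nat) (s : seq (nat * nat * nat * F)).
Variable sP : well_graded m s.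
Local Notation T := (table n sP).
Local Notation d i := (delta_mx 0 i : T).

Lemma table_homogeneous_span :
  homogeneous_span (fun i : 'I_(m + n) => odd_index m i) (fun i => d i).
Proof.
move=> b P P0 PD Pd x /mem_table_gr x0; rewrite (row_sum_delta x).
apply: big_rec => // i y _ Py.
have [ib|/x0->] := eqVneq (odd_index m i) b; last by rewrite scale0r add0r.
exact: PD (Pd i ib) Py.
Qed.

Lemma table_ind (P : T -> Prop) :
    P 0 -> (forall a x y, P x -> P y -> P (a *: x + y)) ->
    (forall i : 'I_(m + n), P (d i)) -> forall x, P x.
Proof.
move=> P0 PD Pd x; rewrite (row_sum_delta x).
by apply: big_rec => // i y _ Py; exact: PD (Pd i) Py.
Qed.

End BasisExtension.

(** * Tables with half-integral structure constants *)

Section IntegerTables.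

(* Twice the structure constants of a table whose entries are half-integers.   *)
Definition icoef (m : nat) (s : seq (nat * nat * nat * int)) (i j k : nat) : int :=
  foldr (fun t acc => acc +
    if (i, j, k) == t.1 then t.2
    else if (j, i, k) == t.1 then
      if odd_index m i && odd_index m j then - t.2 else t.2
    else 0) 0 s.

Definition half_table (F : fieldType) (s : seq (nat * nat * nat * int)) :
  seq (nat * nat * nat * F) := [seq (t.1, t.2%:~R / 2%:R) | t <- s].

Definition isum (N : nat) (f : nat -> int) : int :=
  foldr (fun i acc => f i + acc) 0 (iota 0 N).

Definition iall (N : nat) (p : pred nat) : bool := all p (iota 0 N).
Definition ihas (N : nat) (p : pred nat) : bool := has p (iota 0 N).

Lemma iallP N (p : pred nat) : reflect (forall i : 'I_N, p i) (iall N p).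
Proof.
apply: (iffP allP) => [H i|H i]; first by apply: H; rewrite mem_iota /= add0n.
by rewrite mem_iota add0n /= => iN; have := H (Ordinal iN).
Qed.

Lemma ihasP N (p : pred nat) : reflect (exists i : 'I_N, p i) (ihas N p).
Proof.
apply: (iffP hasP) => [[k] | [k pk]]; last by exists (val k); rewrite // mem_iota /= add0n.
by rewrite mem_iota add0n /= => kN pk; exists (Ordinal kN).
Qed.

Lemma isumE (R : pzRingType) N f :
  (isum N f)%:~R = \sum_(i < N) (f i)%:~R :> R.
Proof.
rewrite /isum -(big_mkord xpredT (fun i => (f i)%:~R)) /index_iota subn0.
elim: (iota 0 N) => [|i l IHl]; first by rewrite big_nil.
by rewrite /= big_cons intrD IHl.
Qed.

Lemma icoefE (F : numFieldType) m s i j k :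
  table_coef m (half_table F s) i j k = (icoef m s i j k)%:~R / 2%:R.
Proof.
rewrite /table_coef big_map; elim: s => [|[[[i' j'] k'] a] s IHs].
  by rewrite big_nil mul0r.
rewrite big_cons IHs /= addrC intrD mulrDl; congr (_ + _).
case: eqP => // _; case: eqP => _; last by rewrite mul0r.
case: odd_index; case: odd_index => /=; rewrite ?mul1r //.
by rewrite mulN1r intrN mulNr.
Qed.

(* Vectors are sequences of coordinates and [c] stands for twice the structure *)
(* constants, so that each product below carries a factor 2.                   *)
Section IntegerAlgebra.
Variables (N : nat) (od : nat -> bool) (c : nat -> nat -> nat -> int).

Definition idelta (i : nat) : seq int := mkseq (fun k => Posz (k == i)) N.

(** The tests for zero do not change the value; they skip inner sums when the vectors are sparse. *)
Definition imul (x y : seq int) : seq int :=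
  mkseq (fun k => isum N (fun i => if nth 0 x i == 0 then 0 else nth 0 x i *
    isum N (fun j => if nth 0 y j == 0 then 0 else nth 0 y j * c i j k))) N.

Definition isupercommutative : bool :=
  iall N (fun i => iall N (fun j => iall N (fun k =>
    c i j k == if od i && od j then - c j i k else c j i k))).

Definition isign (b : bool) (a : int) : int := if b then - a else a.

Definition ijordan_at (i j k l : nat) (x y z t : seq int) : bool :=
  let M := imul in
  let o := od in
  let A1 := M (M (M x y) z) t in
  let A2 := M (M (M x t) z) y in
  let A3 := M (M (M y t) z) x in
  let B1 := M (M x y) (M z t) in
  let B2 := M (M x t) (M y z) in
  let B3 := M (M x z) (M y t) in
  iall N (fun p =>
    nth 0 A1 p
      + isign ((o j && o k) (+) (o j && o l) (+) (o k && o l)) (nth 0 A2 p)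
      + isign ((o i && o j) (+) (o i && o k) (+) (o i && o l) (+) (o k && o l))
          (nth 0 A3 p)
    == nth 0 B1 p + isign (o l && (o j (+) o k)) (nth 0 B2 p)
      + isign (o j && o k) (nth 0 B3 p)).

Definition ijordan : bool :=
  iall N (fun i => iall N (fun j => iall N (fun k => iall N (fun l =>
    ijordan_at i j k l (idelta i) (idelta j) (idelta k) (idelta l))))).

Definition iproduct (a b : bool) : bool :=
  ihas N (fun i => ihas N (fun j => ihas N (fun k =>
    [&& od i == a, od j == b & c i j k != 0]))).

Definition iaction (d : nat) : bool :=
  ihas N (fun i => ihas N (fun i' => ihas N (fun j => [&& ~~ od i, ~~ od i', od j &
    let x := idelta i in let x' := idelta i' in let y := idelta j in
    let u := imul x (imul x' y) in let v := imul (imul x x') y in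
    ihas N (fun p => nth 0 u p *+ d != nth 0 v p)]))).

(* If [killed p], then some coordinate of some product b_i y with y odd is a   *)
(* nonzero multiple of y_p, so y_p = 0 as soon as y is annihilated.            *)
Definition iannihilator_trivial : bool :=
  let killed p := ihas N (fun i => ihas N (fun l => (c i p l != 0) &&
     iall N (fun q => [|| q == p, ~~ od q | c i q l == 0]))) in
  let alive := [seq p <- iota 0 N | od p && ~~ killed p] in
  (size alive <= 1)%N &&
  all (fun p => ihas N (fun i => ihas N (fun j => (c i j p != 0) &&
     iall N (fun k => (k == p) || (c i j k == 0))))) alive.

End IntegerAlgebra.

(** * From integer computations to identities over the field *)

Section IntegerSoundness.
Variables (F : numFieldType) (m n : nat) (s : seq (nat * nat * nat * F)).
Variable sP : well_graded m s.
Variable c : nat -> nat -> nat -> int.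
Hypothesis cE : forall i j k, table_coef m s i j k = (c i j k)%:~R / 2%:R.
Local Notation N := (m + n)%N.
Local Notation T := (table n sP).
Local Notation od := (odd_index m).
Local Notation d i := (delta_mx 0 i : T).

Let two0 : 2%:R != 0 :> F. Proof. by rewrite pnatr_eq0. Qed.

Definition interp (x : seq int) : T := \row_(i < N) (nth 0 x i)%:~R.

Lemma interp_delta (i : 'I_N) : interp (idelta N i) = d i.
Proof.
by apply/rowP=> k; rewrite !mxE nth_mkseq //= -val_eqE /= pmulrn.
Qed.

Lemma interp_mul x y : interp (imul N c x y) = 2%:R *: (interp x ** interp y).
Proof.
apply/rowP=> k; rewrite mxE nth_mkseq // isumE mxE table_mulE summxE mulr_sumr.
have skip0 (a b : int) : (if a == 0 then 0 else a * b) = a * b.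
  by case: eqP => // ->; rewrite mul0r.
apply: eq_bigr => i _; rewrite summxE skip0 intrM isumE !mulr_sumr.
apply: eq_bigr => j _; rewrite !mxE cE skip0 intrM mulrCA mulrA -!mulrA.
by rewrite [2%:R * _]mulrC !mulrA divfK // mulrAC mulrC mulrA.
Qed.

Let isignE b a : (isign b a)%:~R = (-1) ^+ b * a%:~R :> F.
Proof. by case: b; rewrite /= ?mulN1r ?intrN ?mul1r. Qed.

Let interp_sum3 (b1 b2 b3 b4 : bool) a1 a2 a3 a4 a5 a6 :
  iall N (fun p => nth 0 a1 p + isign b1 (nth 0 a2 p) + isign b2 (nth 0 a3 p)
    == nth 0 a4 p + isign b3 (nth 0 a5 p) + isign b4 (nth 0 a6 p)) ->
  interp a1 + (-1) ^+ b1 *: interp a2 + (-1) ^+ b2 *: interp a3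
  = interp a4 + (-1) ^+ b3 *: interp a5 + (-1) ^+ b4 *: interp a6.
Proof.
move=> /iallP H; apply/rowP=> p; rewrite !mxE.
by have /eqP/(congr1 (fun a : int => a%:~R : F)) := H p; rewrite !intrD !isignE.
Qed.

Let cancel_sum3 (V : lmodType F) e s1 s2 s3 s4 (a1 a2 a3 a4 a5 a6 : V) : e != 0 ->
  e *: a1 + s1 *: (e *: a2) + s2 *: (e *: a3)
    = e *: a4 + s3 *: (e *: a5) + s4 *: (e *: a6) ->
  a1 + s1 *: a2 + s2 *: a3 = a4 + s3 *: a5 + s4 *: a6.
Proof.
move=> e0; rewrite !(scalerA _ e) ![_ * e]mulrC -!scalerA -!scalerDr.
exact: scalerI.
Qed.

Lemma icoef_delta (i j k : 'I_N) : (d i ** d j) 0 k = (c i j k)%:~R / 2%:R.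
Proof. by rewrite delta_mul mxE cE. Qed.

Lemma isupercommutativeP : isupercommutative N od c -> supercommutative T.
Proof.
move=> H; apply: (supercommutative_homogeneous_span (@table_homogeneous_span _ _ n _ sP)).
move=> i j; apply/rowP=> k; rewrite icoef_delta [RHS]mxE icoef_delta.
have /iallP/(_ j)/iallP/(_ k)/eqP-> := iallP _ _ H i.
by case: (od i); case: (od j); rewrite /= ?expr0 ?expr1 ?mul1r // intrN mulN1r mulNr.
Qed.

Lemma ijordan_atP (i j k l : nat) x y z t : ijordan_at N od c i j k l x y z t ->
  jordan_at (od i) (od j) (od k) (od l) (interp x) (interp y) (interp z) (interp t).
Proof.
move=> /interp_sum3; have := interp_mul; move: (imul N c) => M IM; rewrite !IM.
move: (interp x) (interp y) (interp z) (interp t) => {IM} {}x {}y {}z {}t.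
(* Each of the six terms involves three products, so all of them carry the factor 8, which
   cancels. *)
rewrite !(sa_mulZl, sa_mulZr) !(scalerA 2%:R 2%:R) !(scalerA (2%:R * 2%:R) 2%:R).
move=> /cancel_sum3 H; rewrite /jordan_at.
have sg k' : (-1) ^+ k' = (-1) ^+ odd k' :> F by rewrite signr_odd.
rewrite (sg (od j * od k + _ + _)%N) (sg (od i * od j + _ + _ + _)%N).
rewrite (sg (od l * _)%N) (sg (od j * od k)%N).
rewrite !(oddD, oddM) !oddb; apply: H.
by rewrite !mulf_neq0.
Qed.

Lemma ijordanP : ijordan N od c -> jordan_identity T.
Proof.
move=> H; apply: (jordan_homogeneous_span (@table_homogeneous_span _ _ n _ sP)).
move=> i j k l; rewrite -!interp_delta; apply: ijordan_atP.
by have /iallP/(_ j)/iallP/(_ k)/iallP/(_ l) := iallP _ _ H i.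
Qed.

Let coef_eq0 i j k : ((c i j k)%:~R / 2%:R == 0 :> F) = (c i j k == 0).
Proof. by rewrite mulf_eq0 invr_eq0 (negPf two0) orbF intr_eq0. Qed.

Lemma iproductP a b : reflect (product_nontriv T a b) (iproduct N od c a b).
Proof.
apply: (iffP idP) => [/ihasP[i /ihasP[j /ihasP[k /and3P[/eqP <- /eqP <- cijk]]]]|].
  exists (d i), (d j); split; try exact: delta_gr.
  apply: contra cijk => /eqP dij; rewrite -coef_eq0 -icoef_delta.
  by rewrite dij mxE.
move=> H; apply: contraPT H => H.
apply: (product_triv_homogeneous_span (@table_homogeneous_span _ _ n _ sP)).
move=> i j ia jb; apply/rowP=> k; rewrite icoef_delta mxE; apply/eqP.
rewrite coef_eq0; apply: contraNT H => cijk.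
by apply/ihasP; exists i; apply/ihasP; exists j; apply/ihasP; exists k;
  rewrite ia jb !eqxx.
Qed.

Lemma interp_eq (x y : seq int) :
  reflect (interp x = interp y) (~~ ihas N (fun p => nth 0 x p != nth 0 y p)).
Proof.
apply: (iffP idP) => [H|/rowP H].
  apply/rowP=> p; rewrite !mxE; apply/eqP; rewrite eqr_int.
  by apply: contraNT H => xy; apply/ihasP; exists p.
apply/negP=> /ihasP[p]; have /eqP := H p.
by rewrite !mxE eqr_int => ->.
Qed.

(** Both sides of the tested identity involve two products, hence the common factor 4. *)
Lemma iactionP k : reflect (action_nontriv T k) (iaction N od c k).
Proof.
pose u (i i' j : nat) := imul N c (idelta N i) (imul N c (idelta N i') (idelta N j)).
pose v (i i' j : nat) := imul N c (imul N c (idelta N i) (idelta N i')) (idelta N j).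
have uE (i i' j : 'I_N) : interp (mkseq (fun p => nth 0 (u i i' j) p *+ k) N)
    = (2%:R * 2%:R) *: (d i ** (d i' ** d j) *+ k).
  transitivity (interp (u i i' j) *+ k).
    apply/rowP=> p; rewrite mxE nth_mkseq //; rewrite mulmxnE.
    by rewrite mxE rmorphMn.
  by rewrite !interp_mul !interp_delta sa_mulZr scalerA scalerMnr.
have vE (i i' j : 'I_N) : interp (v i i' j) = (2%:R * 2%:R) *: ((d i ** d i') ** d j).
  by rewrite !interp_mul !interp_delta sa_mulZl scalerA.
have four0 : 2%:R * 2%:R != 0 :> F by rewrite mulf_neq0.
have same (i i' j : 'I_N) : d i ** (d i' ** d j) *+ k = (d i ** d i') ** d j <->
    ~~ ihas N (fun p => nth 0 (u i i' j) p *+ k != nth 0 (v i i' j) p).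
  have -> : ihas N (fun p => nth 0 (u i i' j) p *+ k != nth 0 (v i i' j) p) =
    ihas N (fun p => nth 0 (mkseq (fun p => nth 0 (u i i' j) p *+ k) N) p
      != nth 0 (v i i' j) p).
    by apply/ihasP/ihasP=> -[p Hp]; exists p; move: Hp; rewrite nth_mkseq.
  split=> [e|/interp_eq]; last by rewrite uE vE => /(scalerI four0).
  by apply/interp_eq; rewrite uE vE e.
apply: (iffP idP).
  case/ihasP=> i /ihasP[i' /ihasP[j /and4P[oi oi' oj H]]].
  exists (d i), (d i'), (d j); split.
  - by rewrite -(negPf oi) delta_gr.
  - by rewrite -(negPf oi') delta_gr.
  - by rewrite -oj delta_gr.
  - by apply/eqP=> /same/negP; apply.
move=> H; apply: contraPT H => H.
apply: (action_triv_homogeneous_span (@table_homogeneous_span _ _ n _ sP)).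
move=> i i' j oi oi' oj; apply/same; apply: contra H => H.
apply/ihasP; exists i; apply/ihasP; exists i'; apply/ihasP; exists j.
by rewrite oi oi' oj.
Qed.

(** An annihilated odd y has no coordinate outside [alive], which has at most one element p. So y is
    a multiple of b_p, possibly zero, and b_p is proportional to a product of two basis vectors. *)
Lemma iannihilator_trivialP : m = 1%N -> iannihilator_trivial N od c ->
  indecomposable T.
Proof.
move=> m1 /=/andP[]; set alive := [seq p <- _ | _] => alive1 aliveP.
have [dim0 _] := table_dim_gr n sP.
apply: indecomposableI => [|y /mem_table_gr y0 yann]; first by rewrite dim0.
have y_eq0 : (forall q, y 0 q = 0) -> exists x z : T, y = x ** z.
  move=> y_0; exists 0, 0; transitivity (0 : T); last exact/esym/sa_mul0l.
  by apply/rowP=> q; rewrite y_0 mxE.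
(* The sum is twice the l-th coordinate of b_i y. *)
have coefE (i l : 'I_N) : \sum_(p < N) y 0 p * (c i p l)%:~R = 0.
  transitivity ((d i ** y) 0 l * 2%:R); last by rewrite yann mxE mul0r.
  rewrite [y in _ ** y]row_sum_delta bilin_sumr summxE mulr_suml.
  apply: eq_bigr => p _; rewrite sa_mulZr [X in _ = X * _]mxE icoef_delta.
  by rewrite -mulrA divfK.
have dead (p : 'I_N) : od p -> val p \notin alive -> y 0 p = 0.
  rewrite mem_filter mem_iota /= add0n ltn_ord andbT negb_and => ->.
  rewrite negbK /= => /ihasP[i /ihasP[l /andP[cipl /iallP H]]].
  have := coefE i l; rewrite (bigD1 p) //= big1 ?addr0 => [/eqP|q qp].
    by rewrite mulf_eq0 intr_eq0 (negPf cipl) orbF => /eqP.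
  have /or3P[/eqP/val_inj e|oq|/eqP->] := H q; first by rewrite e eqxx in qp.
    by rewrite y0 ?mul0r // (negPf oq).
  by rewrite mulr0.
case: alive alive1 aliveP dead => [|p [|//]] _ => [_|/=/andP[]] dead.
  apply: y_eq0 => q.
  have [oq|oq] := boolP (od q); first exact: dead.
  by rewrite y0 // (negPf oq).
case/ihasP: dead => i /ihasP[j /andP[cp /iallP H]] _ dead.
have e : d i ** d j = ((c i j p)%:~R / 2%:R) *: (\row_(k < N) (k == p :> nat)%:R : T).
  apply/rowP=> k; rewrite icoef_delta !mxE.
  have [->|kp] := eqVneq (k : nat) p; first by rewrite mulr1.
  by have := H k; rewrite (negPf kp) /= => /eqP->; rewrite mulr0 mul0r.
have [pN|pN] := ltnP p N; last first.
  apply: y_eq0 => q.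
  have [oq|oq] := boolP (od q); last by rewrite y0 // (negPf oq).
  apply: dead => //; rewrite inE; apply: contraL pN => /eqP <-.
  by rewrite -ltnNge ltn_ord.
pose a := y 0 (Ordinal pN) / ((c i j p)%:~R / 2%:R).
exists (a *: d i), (d j); transitivity (a *: (d i ** d j)); last first.
  exact: esym (@sa_mulZl _ T a (d i) (d j)).
rewrite e scalerA divfK ?coef_eq0 //; apply/rowP=> q; rewrite !mxE.
have [qp|qp] := eqVneq (q : nat) p.
  by rewrite mulr1; congr (y 0 _); apply: val_inj.
rewrite mulr0; have [oq|oq] := boolP (od q); last by rewrite y0 // (negPf oq).
by apply: dead; rewrite // inE.
Qed.

End IntegerSoundness.

End IntegerTables.

(** * Derivations *)

Section FullRank.

(* Fraction-free Gaussian elimination.                                         *)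
Definition ireduce (p r : seq int) : seq int :=
  if head 0 r == 0 then behead r else
  mkseq (fun i => head 0 p * nth 0 r i.+1 - head 0 r * nth 0 p i.+1) (size p).-1.

Fixpoint full_rank (k : nat) (rows : seq (seq int)) : bool :=
  if k is k'.+1 then
    if [seq r <- rows | head 0 r != 0] is p :: _ then
      full_rank k' [seq ireduce p r | r <- rows]
    else false
  else true.

(** The reduced rows are consequences of the system without the first unknown, so by induction the
    later unknowns vanish; the pivot row then kills the first one. *)
Lemma full_rankP (F : numFieldType) k rows (v : nat -> F) :
    full_rank k rows -> all (fun r => size r == k) rows ->
    (forall r, r \in rows -> \sum_(i < k) (nth 0 r i)%:~R * v i = 0) ->
  forall i, (i < k)%N -> v i = 0.
Proof.
elim: k rows v => [//|k IHk] rows v /=.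
case E: [seq _ <- _ | _] => [//|p l] rk sz rv.
have : p \in [seq r <- rows | head 0 r != 0] by rewrite E mem_head.
rewrite mem_filter => /andP[p0 pr].
have /allP sz' := sz; have /eqP szp := sz' p pr.
have vS i : (i < k)%N -> v i.+1 = 0.
  apply: (IHk _ (fun i => v i.+1) rk).
    apply/allP=> _ /mapP[r rr ->]; rewrite /ireduce; case: ifP => _.
      by rewrite size_behead (eqP (sz' r rr)).
    by rewrite size_mkseq szp.
  move=> _ /mapP[r rr ->]; have := rv r rr; have := rv p pr.
  rewrite !big_ord_recl !nth0 /= => ep er; rewrite /ireduce; case: ifP => [/eqP r0|_].
    by rewrite -[RHS]er r0 mul0r add0r; apply: eq_bigr => j _; rewrite nth_behead.
  transitivity ((head 0 p)%:~R * (\sum_(i < k) (nth 0 r i.+1)%:~R * v i.+1)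
    - (head 0 r)%:~R * (\sum_(i < k) (nth 0 p i.+1)%:~R * v i.+1)).
    rewrite !mulr_sumr -sumrB; apply: eq_bigr => j _.
    by rewrite nth_mkseq ?szp //= intrB !intrM mulrBl !mulrA.
  have -> : \sum_(i < k) (nth 0 r i.+1)%:~R * v i.+1 = - ((head 0 r)%:~R * v 0%N).
    by apply/eqP; rewrite -addr_eq0 addrC; apply/eqP.
  have -> : \sum_(i < k) (nth 0 p i.+1)%:~R * v i.+1 = - ((head 0 p)%:~R * v 0%N).
    by apply/eqP; rewrite -addr_eq0 addrC; apply/eqP.
  by rewrite !mulrN opprK mulrCA addrC subrr.
case=> [_|i]; last exact: vS.
have := rv p pr; rewrite big_ord_recl big1 ?addr0 ?nth0 /= => [/eqP|j _].
  by rewrite mulf_eq0 intr_eq0 (negPf p0) => /eqP.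
by rewrite vS ?mulr0 ?ltn_ord.
Qed.

End FullRank.

Section Derivations.
Variables (N : nat) (od : nat -> bool) (c : nat -> nat -> nat -> int).

(* The coefficient of the entry (p, q) of D in twice the l-th coordinate of    *)
(* D (b_i b_j) - D b_i b_j - (-1)^(|D||i|) b_i (D b_j); the sign is read off   *)
(* from the entry, as D_pq can be nonzero only if |D| = |p| + |q|.             *)
Definition rcoef (i j l p q : nat) : int :=
  (if q == l then c i j p else 0) - (if p == i then c q j l else 0)
  - (if p == j then isign (od i && (od p (+) od q)) (c i q l) else 0).

Definition ientry (b : seq (nat * nat * int)) (p q : nat) : int :=
  foldr (fun t acc => acc + if t.1 == (p, q) then t.2 else 0) 0 b.

Definition ihead (b : seq (nat * nat * int)) : nat * nat := (head (0%N, 0%N, 0) b).1.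

Definition ideg (pq : nat * nat) : bool := od pq.1 (+) od pq.2.

Definition ideriv (b : seq (nat * nat * int)) : bool :=
  all (fun t => ideg t.1 == ideg (ihead b)) b &&
  iall N (fun i => iall N (fun j => iall N (fun l =>
    isum N (fun p => isum N (fun q => rcoef i j l p q * ientry b p q)) == 0))).

(* Each matrix of [bs] is a list of entries (row, column, value). Its first    *)
(* entry is 1 and is 0 in the other matrices, and a solution of the linear     *)
(* system for derivations that vanishes at all these first entries is 0.       *)
Definition iDer_basis (bs : seq (seq (nat * nat * int))) : bool :=
  let hs := map ihead bs in
  let cols := [seq pq <- [seq (p, q) | p <- iota 0 N, q <- iota 0 N] | pq \notin hs] in
  [&& all ideriv bs,
      all (fun pq => (pq.1 < N)%N && (pq.2 < N)%N) hs,
      iall (size bs) (fun r => iall (size bs) (fun r' =>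
        let pq := ihead (nth [::] bs r') in
        ientry (nth [::] bs r) pq.1 pq.2 == (r == r'))) &
      full_rank (size cols)
        (flatten [seq flatten [seq [seq [seq rcoef i j l pq.1 pq.2 | pq <- cols]
                 | l <- iota 0 N] | j <- iota 0 N] | i <- iota 0 N])].

End Derivations.

(** * Derivations as solutions of an integer linear system *)

Section DerivationsSound.
Variables (F : numFieldType) (m n : nat) (s : seq (nat * nat * nat * F)).
Variable sP : well_graded m s.
Variable c : nat -> nat -> nat -> int.
Hypothesis cE : forall i j k, table_coef m s i j k = (c i j k)%:~R / 2%:R.
Local Notation N := (m + n)%N.
Local Notation T := (table n sP).
Local Notation od := (odd_index m).
Local Notation d i := (delta_mx 0 i : T).
Implicit Type M : 'M[F]_N.

Let two0 : 2%:R != 0 :> F. Proof. by rewrite pnatr_eq0. Qed.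

Definition residual M (i j l : nat) : F :=
  \sum_(p < N) \sum_(q < N) (rcoef od c i j l p q)%:~R * M p q.

Let if_intr (b : bool) (a : int) x : (if b then a else 0)%:~R * x = if b then a%:~R * x else 0 :> F.
Proof. by case: b; rewrite ?mul0r. Qed.

Lemma residualE M (i j l : 'I_N) : residual M i j l =
  \sum_(p < N) (c i j p)%:~R * M p l - \sum_(q < N) (c q j l)%:~R * M i q
  - \sum_(q < N) (-1) ^+ (od i && (od j (+) od q)) * (c i q l)%:~R * M j q.
Proof.
rewrite /residual.
under eq_bigr => p _.
  under eq_bigr => q _.
    rewrite /rcoef !intrB !mulrBl !if_intr; over.
  rewrite !sumrB; over.
rewrite !sumrB; congr (_ - _ - _).
- by apply: eq_bigr => p _; rewrite -big_mkcond (big_pred1 l).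
- rewrite exchange_big; apply: eq_bigr => q _.
  by rewrite -big_mkcond (big_pred1 i).
- rewrite exchange_big; apply: eq_bigr => q _.
  rewrite -big_mkcond (big_pred1 j) //; congr (_ * _).
  by case: andb; rewrite /= ?expr1 ?mulN1r ?intrN ?mul1r.
Qed.

Definition hom_mx (b : bool) M : Prop :=
  forall p q : 'I_N, od p (+) od q != b -> M p q = 0.

Lemma mulmx_gr b M i (x : T) : hom_mx b M -> x \in sa_gr T i ->
  (x *m M : T) \in sa_gr T (b (+) i).
Proof.
move=> Mb /mem_table_gr x0; apply/mem_table_gr=> q qb; rewrite mxE big1 // => p _.
have [pi|/x0->] := eqVneq (od p) i; last by rewrite mul0r.
rewrite Mb ?mulr0 //; apply: contra qb => /eqP <-.
by rewrite -pi addbAC addbb.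
Qed.

(** Matrices act on row vectors from the right, so M p q is the coordinate along b_q of the image of
    b_p. *)
Definition mx_end M : 'End(T) := linfun (mulmxr M).

Lemma mx_endE M (x : T) : mx_end M x = x *m M.
Proof. by rewrite lfunE. Qed.

Definition twist (b : bool) M (i j l : 'I_N) : F :=
  (d i ** d j *m M) 0 l - ((d i *m M : T) ** d j) 0 l
  - (-1) ^+ (b * od i) * (d i ** (d j *m M : T)) 0 l.

Let row_delta M (i : 'I_N) : d i *m M = \sum_q M i q *: d q.
Proof. by rewrite -rowE (row_sum_delta (row i M)); apply: eq_bigr => q _; rewrite mxE. Qed.

(** The sign in [rcoef] agrees with (-1)^(b |i|) wherever a matrix of degree b can have a nonzero
    entry. The factor 2 comes from the doubled structure constants. *)
Lemma residual_twist b M (i j l : 'I_N) : hom_mx b M ->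
  residual M i j l = 2%:R * twist b M i j l.
Proof.
move=> Mb; rewrite residualE /twist !mulrBr; congr (_ - _ - _).
- rewrite [in RHS]mxE mulr_sumr; apply: eq_bigr => p _.
  by rewrite (icoef_delta sP cE) !mulrA [2%:R * _]mulrC mulfK.
- rewrite row_delta bilin_suml summxE mulr_sumr; apply: eq_bigr => q _.
  rewrite sa_mulZl [X in _ = _ * X]mxE (icoef_delta sP cE).
  by rewrite mulrCA [2%:R * _]mulrC divfK // mulrC.
rewrite row_delta bilin_sumr summxE !mulr_sumr; apply: eq_bigr => q _.
rewrite sa_mulZr [X in _ = _ * (_ * X)]mxE (icoef_delta sP cE).
have [jq|/Mb->] := eqVneq (od j (+) od q) b; last by rewrite !(mul0r, mulr0).
have -> : (-1) ^+ (b * od i) = (-1) ^+ (od i && (od j (+) od q)) :> F.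
  by rewrite jq mulnb andbC.
rewrite [RHS]mulrCA -[in LHS]mulrA; congr (_ * _).
by rewrite [RHS]mulrCA [2%:R * _]mulrC divfK // mulrC.
Qed.

Let add_coord (u v : T) l : (u + v) 0 l = u 0 l + v 0 l.
Proof. by rewrite mxE. Qed.

Let scale_coord a (u : T) l : (a *: u) 0 l = a * u 0 l.
Proof. by rewrite mxE. Qed.

Lemma derivation_mx b (D : 'End(T)) : derivation b D ->
  exists2 M, D = mx_end M & hom_mx b M /\ forall i j l : 'I_N, residual M i j l = 0.
Proof.
move=> [Dgr Dd]; pose M : 'M[F]_N := \matrix_(p, q) (D (d p)) 0 q.
have dM p : d p *m M = D (d p).
  by rewrite -rowE; apply/rowP=> q; rewrite !mxE.
have DM : D = mx_end M.
  apply/lfunP=> x; rewrite mx_endE [x in D x]row_sum_delta [x in RHS]row_sum_delta.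
  rewrite linear_sum mulmx_suml; apply: eq_bigr => p _.
  by rewrite linearZ -scalemxAl dM.
have Mb : hom_mx b M.
  move=> p q pq; have := memv_img D (delta_gr sP p).
  move/(subvP (Dgr _))/mem_table_gr => /(_ q); rewrite mxE; apply.
  by apply: contra pq => /eqP->; rewrite addbCA addbb addbF.
exists M => //; split=> // i j l; rewrite (residual_twist _ _ _ Mb) /twist !dM.
have := congr1 (fun v : T => v 0 l) (Dd _ _ (d j) (delta_gr sP i)).
rewrite DM mx_endE => ->; rewrite add_coord scale_coord -DM.
by rewrite addrAC addrK subrr mulr0.
Qed.

Lemma mx_derivation b M : hom_mx b M -> (forall i j l : 'I_N, residual M i j l = 0) ->
  derivation b (mx_end M).
Proof.
move=> Mb Mr; split=> [i|i x y].
  by apply/subvP=> _ /memv_imgP[x Tx ->]; rewrite mx_endE; exact: mulmx_gr.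
have E0 : mx_end M 0 = 0 by exact: linear0.
have EP a x1 x2 : mx_end M (a *: x1 + x2) = a *: mx_end M x1 + mx_end M x2.
  exact: linearP.
move: x; apply: (@table_homogeneous_span _ _ n _ sP) => [|a x x' Hx Hx'|i' <-].
- by rewrite sa_mul0l E0 !sa_mul0l scaler0 addr0.
- rewrite sa_mulPl !EP !sa_mulPl Hx Hx'.
  by rewrite !scalerDr !scalerA [a * _]mulrC addrACA.
move: y; apply: table_ind => [|a y y' Hy Hy'|j].
- by rewrite sa_mul0r E0 !sa_mul0r scaler0 addr0.
- rewrite sa_mulPr !EP !sa_mulPr Hy Hy'.
  by rewrite !scalerDr !scalerA [a * _]mulrC addrACA.
apply/rowP=> l; have := Mr i' j l; rewrite (residual_twist _ _ _ Mb) => /eqP.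
rewrite mulf_eq0 (negPf two0) /= /twist !mx_endE subr_eq0 subr_eq => /eqP->.
by rewrite add_coord scale_coord addrC.
Qed.

Definition entry M (pq : nat * nat) : F :=
  if insub pq.1 is Some p then if insub pq.2 is Some q then M p q else 0 else 0.

Lemma entryE M (p q : 'I_N) : entry M (val p, val q) = M p q.
Proof. by rewrite /entry !valK. Qed.

Let entry_sum I (r : seq I) (a : I -> F) (E : I -> 'M_N) pq :
  entry (\sum_(k <- r) a k *: E k) pq = \sum_(k <- r) a k * entry (E k) pq.
Proof.
case: pq => p q; rewrite /entry /=; case: insub => [p'|]; last first.
  by rewrite big1 // => k _; rewrite mulr0.
case: insub => [q'|]; last by rewrite big1 // => k _; rewrite mulr0.
by rewrite summxE; apply: eq_bigr => k _; rewrite mxE.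
Qed.

Let entryB M M' pq : entry (M - M') pq = entry M pq - entry M' pq.
Proof.
case: pq => p q; rewrite /entry /=; case: insub => [p'|]; rewrite ?subr0 //.
by case: insub => [q'|]; rewrite ?subr0 // !mxE.
Qed.

Lemma residualB M M' i j l : residual (M - M') i j l = residual M i j l - residual M' i j l.
Proof.
rewrite /residual -sumrB; apply: eq_bigr => p _; rewrite -sumrB.
by apply: eq_bigr => q _; rewrite !mxE mulrBr.
Qed.

Lemma residual_sum I (r : seq I) (a : I -> F) (E : I -> 'M_N) i j l :
  residual (\sum_(k <- r) a k *: E k) i j l = \sum_(k <- r) a k * residual (E k) i j l.
Proof.
rewrite /residual; under [RHS]eq_bigr do rewrite mulr_sumr.
rewrite [RHS]exchange_big; apply: eq_bigr => p _ /=.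
under [RHS]eq_bigr do rewrite mulr_sumr.
rewrite [RHS]exchange_big; apply: eq_bigr => q _ /=.
rewrite summxE mulr_sumr; apply: eq_bigr => k _.
by rewrite mxE mulrCA.
Qed.

(** Once the entries in [hs] are zero, the remaining ones solve the system restricted to [cols],
    which has full column rank. *)
Lemma residual_eq0 (hs : seq (nat * nat)) M
    (cols := [seq pq <- [seq (p, q) | p <- iota 0 N, q <- iota 0 N] | pq \notin hs]) :
    full_rank (size cols)
      (flatten [seq flatten [seq [seq [seq rcoef od c i j l pq.1 pq.2 | pq <- cols]
               | l <- iota 0 N] | j <- iota 0 N] | i <- iota 0 N]) ->
    (forall i j l : 'I_N, residual M i j l = 0) ->
    (forall pq, pq \in hs -> entry M pq = 0) ->
  M = 0.
Proof.
move=> rk Mr Mh.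
have iotaE (f : nat -> F) : \sum_(k <- iota 0 N) f k = \sum_(k < N) f k.
  by rewrite -(big_mkord xpredT f) /index_iota subn0.
pose v k := entry M (nth (0, 0)%N cols k).
have v0 k : (k < size cols)%N -> v k = 0.
  apply: (full_rankP rk).
    apply/allP=> _ /flattenP[_ /mapP[i _ ->] /flattenP[_ /mapP[j _ ->] /mapP[l _ ->]]].
    by rewrite size_map.
  move=> _ /flattenP[_ /mapP[i iN ->] /flattenP[_ /mapP[j jN ->] /mapP[l lN ->]]].
  move: iN jN lN; rewrite !mem_iota !add0n /= => iN jN lN.
  rewrite -[RHS](Mr (Ordinal iN) (Ordinal jN) (Ordinal lN)) /residual /=.
  transitivity (\sum_(pq <- cols) (rcoef od c i j l pq.1 pq.2)%:~R * entry M pq).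
    rewrite (big_nth (0, 0)%N) big_mkord; apply: eq_bigr => k' _.
    by rewrite (nth_map (0, 0)%N).
  rewrite big_filter big_mkcond big_allpairs_dep iotaE; apply: eq_bigr => p _.
  rewrite iotaE; apply: eq_bigr => q _ /=; case: ifPn => [_|].
    by rewrite (entryE M p q).
  by rewrite negbK => /Mh; rewrite (entryE M p q) => ->; rewrite mulr0.
apply/matrixP=> p q; rewrite mxE -entryE.
have [/Mh//|hp] := boolP ((val p, val q) \in hs).
have pc : (val p, val q) \in cols.
  rewrite mem_filter hp; apply/allpairsP; exists (val p, val q).
  by split; rewrite // mem_iota /= ltn_ord.
by rewrite -(nth_index (0, 0)%N pc); apply: v0; rewrite index_mem.
Qed.

Definition int_mx (b : seq (nat * nat * int)) : 'M[F]_N :=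
  \matrix_(p, q) (ientry b p q)%:~R.

Lemma iderivP b : ideriv N od c b -> hom_mx (ideg od (ihead b)) (int_mx b) /\
  forall i j l : 'I_N, residual (int_mx b) i j l = 0.
Proof.
case/andP=> bdeg bres; split=> [p q pq|i j l].
  rewrite mxE; move: (ideg od (ihead b)) bdeg pq => e bdeg pq.
  elim: b bdeg {bres} => [//|t b IHb] /= /andP[te be]; rewrite intrD IHb // add0r.
  by case: eqP => // tpq; move: te pq; rewrite tpq /ideg /= => ->.
have /iallP/(_ j)/iallP/(_ l)/eqP/(congr1 (fun a : int => a%:~R : F)) := iallP _ _ bres i.
rewrite isumE => e; rewrite -[RHS]e; apply: eq_bigr => p _; rewrite isumE; apply: eq_bigr => q _.
by rewrite mxE intrM.
Qed.

(** The values at the first entries form an identity matrix, which gives independence. For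
    generation, subtract from a derivation the combination of [bs] with the same first entries: the
    difference solves the system and vanishes at these entries, so [residual_eq0] applies. *)
Lemma iDer_basisP bs : iDer_basis N od c bs -> \dim (Der T) = size bs.
Proof.
case/and4P=> /allP bsder /allP hsN hsid rk.
pose b (r : 'I_(size bs)) := nth [::] bs r.
have bbs r : b r \in bs by rewrite mem_nth.
have entry_b r r' : entry (int_mx (b r)) (ihead (b r')) = (r == r')%:R.
  have /iallP/(_ r')/eqP := iallP _ _ hsid r.
  have /hsN/andP[] := map_f ihead (bbs r').
  rewrite -/(b r) -/(b r'); case: (ihead _) => p q /= pN qN e.
  by rewrite (entryE _ (Ordinal pN) (Ordinal qN)) mxE e pmulrn -val_eqE.
pose X := [tuple mx_end (int_mx (b r)) | r < size bs].
have nthX (a : 'I_(size bs) -> F) :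
    \sum_(r < size bs) a r *: X`_r = mx_end (\sum_r a r *: int_mx (b r)).
  apply/lfunP=> x; rewrite mx_endE mulmx_sumr sum_lfunE; apply: eq_bigr => r _.
  by rewrite -tnth_nth tnth_mktuple scale_lfunE mx_endE -scalemxAr.
have Xfree : free X.
  apply/freeP=> a; rewrite nthX => Xa r.
  have M0 : \sum_r a r *: int_mx (b r) = 0.
    apply/row_matrixP=> p; rewrite rowE -mx_endE Xa lfunE /=.
    by rewrite row0.
  have := congr1 (fun M => entry M (ihead (b r))) M0.
  rewrite entry_sum (bigD1 r) //= entry_b eqxx mulr1 big1 ?addr0 => [->|r' r'r].
    by case: (ihead _) => p q; rewrite /entry; case: insub => // p'; case: insub => // q'; rewrite mxE.
  by rewrite entry_b (negPf r'r) mulr0.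
have [inDer minDer] := set_spanP (fun D : 'End(T) => exists e, derivation e D).
have -> : Der T = <<X>>%VS.
  apply/eqP; rewrite eqEsubv; apply/andP; split; last first.
    apply/span_subvP=> _ /tnthP[r ->]; rewrite tnth_mktuple; apply: inDer.
    have [bd br] := iderivP (bsder _ (bbs r)).
    by exists (ideg od (ihead (b r))); exact: mx_derivation.
  apply: minDer => D [e /derivation_mx[M -> [_ Mr]]].
  pose a r := entry M (ihead (b r)).
  suff /eqP : M - \sum_r a r *: int_mx (b r) = 0.
    rewrite subr_eq0 => /eqP->; rewrite -nthX; apply: rpred_sum => r _.
    by apply/rpredZ/memv_span/mem_nth; rewrite size_tuple.
  apply: (residual_eq0 rk) => [i j l|pq /(nthP (0, 0)%N)[r]].
    rewrite residualB Mr residual_sum big1 ?subr0 // => r _.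
    by rewrite (iderivP (bsder _ (bbs r))).2 mulr0.
  rewrite size_map => rs <-; rewrite (nth_map [::]) //.
  rewrite -[nth _ _ _]/(b (Ordinal rs)) entryB entry_sum (bigD1 (Ordinal rs)) //=.
  rewrite entry_b eqxx mulr1 big1 ?addr0 ?subrr // => r' r'r.
  by rewrite entry_b (negPf r'r) mulr0.
by move: Xfree; rewrite /free size_tuple => /eqP.
Qed.

Lemma iDer_basis_orbit_dim bs : iDer_basis N od c bs ->
  orbit_dim T = (N ^ 2 - size bs)%N.
Proof. by move=> /iDer_basisP e; rewrite /orbit_dim e table_dim. Qed.

End DerivationsSound.

(** * The algebras of the list *)

Definition J_int : seq (seq (nat * nat * nat * int)) := [::
  [:: (1, 2, 0, 2%Z)];
  [:: (0, 1, 2, 2%Z)];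
  [:: (0, 1, 2, 2%Z); (1, 2, 0, 2%Z)];
  [:: (0, 1, 2, 2%Z); (1, 3, 0, 2%Z)];
  [:: (0, 1, 2, 2%Z); (2, 3, 0, 2%Z)];
  [:: (0, 1, 2, 2%Z); (0, 2, 3, 2%Z)];
  [:: (0, 0, 0, 2%Z)];
  [:: (0, 0, 0, 2%Z); (0, 3, 3, 1%Z)];
  [:: (0, 0, 0, 2%Z); (0, 3, 3, 2%Z)];
  [:: (0, 0, 0, 2%Z); (0, 2, 2, 1%Z); (0, 3, 3, 1%Z)];
  [:: (0, 0, 0, 2%Z); (0, 2, 2, 1%Z); (0, 3, 3, 1%Z); (2, 3, 0, 2%Z)];
  [:: (0, 0, 0, 2%Z); (0, 2, 2, 1%Z); (0, 3, 3, 2%Z)];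
  [:: (0, 0, 0, 2%Z); (0, 2, 2, 2%Z); (0, 3, 3, 2%Z)];
  [:: (0, 0, 0, 2%Z); (0, 2, 2, 2%Z); (0, 3, 3, 2%Z); (2, 3, 0, 2%Z)];
  [:: (0, 0, 0, 2%Z); (0, 1, 1, 1%Z); (0, 2, 2, 1%Z); (0, 3, 3, 1%Z)];
  [:: (0, 0, 0, 2%Z); (0, 1, 1, 1%Z); (0, 2, 2, 1%Z); (0, 3, 3, 2%Z)];
  [:: (0, 0, 0, 2%Z); (0, 1, 1, 1%Z); (0, 2, 2, 2%Z); (0, 3, 3, 2%Z)];
  [:: (0, 0, 0, 2%Z); (0, 1, 1, 2%Z); (0, 2, 2, 2%Z); (0, 3, 3, 2%Z)];
  [:: (0, 0, 0, 2%Z); (0, 1, 1, 2%Z); (0, 2, 2, 2%Z); (0, 3, 3, 2%Z);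
    (1, 2, 0, 2%Z)]]%N.

Local Notation unitE p q := [:: (p, q, 1%Z)].

Definition J_der : seq (seq (seq (nat * nat * int))) := [::
  [:: unitE 1 0; [:: (1, 1, 1%Z); (0, 0, 1%Z)]; unitE 1 2; unitE 1 3;
      unitE 2 0; unitE 2 1; [:: (2, 2, 1%Z); (0, 0, 1%Z)]; unitE 2 3;
      unitE 3 0; unitE 3 3];
  [:: unitE 0 2; unitE 0 3; unitE 1 0; [:: (1, 1, 1%Z); (0, 0, -1%Z)];
      unitE 1 2; unitE 1 3; [:: (2, 2, 1%Z); (0, 0, 1%Z)]; unitE 3 2;
      unitE 3 3];
  [:: unitE 1 0; unitE 1 2; unitE 1 3; [:: (2, 0, 1%Z); (0, 2, -1%Z)];
      [:: (2, 2, 1%Z); (0, 0, 1%Z)]; unitE 3 3];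
  [:: unitE 1 0; [:: (1, 1, 1%Z); (2, 2, 2%Z); (0, 0, 1%Z)]; unitE 1 2;
      unitE 1 3; [:: (3, 0, 1%Z); (0, 2, -1%Z)]; unitE 3 2;
      [:: (3, 3, 1%Z); (2, 2, 1%Z); (0, 0, 1%Z)]];
  [:: unitE 1 0; [:: (2, 2, 1%Z); (0, 0, 1%Z)]; unitE 3 2;
      [:: (3, 3, 1%Z); (0, 0, 1%Z); (1, 1, -1%Z)]];
  [:: unitE 0 3; unitE 1 3; [:: (2, 2, 1%Z); (0, 0, -1%Z); (1, 1, 2%Z)];
      [:: (2, 3, 1%Z); (1, 2, 1%Z)];
      [:: (3, 3, 1%Z); (0, 0, 1%Z); (1, 1, -1%Z)]];
  [:: unitE 1 1; unitE 1 2; unitE 1 3; unitE 2 1; unitE 2 2; unitE 2 3;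
      unitE 3 1; unitE 3 2; unitE 3 3];
  [:: unitE 0 3; unitE 1 1; unitE 1 2; unitE 2 1; unitE 2 2; unitE 3 3];
  [:: unitE 1 1; unitE 1 2; unitE 2 1; unitE 2 2; unitE 3 0; unitE 3 3];
  [:: unitE 0 2; unitE 0 3; unitE 1 1; unitE 2 2; unitE 2 3; unitE 3 2;
      unitE 3 3];
  [:: [:: (0, 2, 1%Z); (3, 0, -2%Z)]; [:: (0, 3, 1%Z); (2, 0, 2%Z)];
      unitE 1 1; unitE 2 3; unitE 3 2; [:: (3, 3, 1%Z); (2, 2, -1%Z)]];
  [:: unitE 0 2; unitE 1 1; unitE 2 2; unitE 3 3];
  [:: unitE 1 1; unitE 2 2; unitE 2 3; unitE 3 2; unitE 3 3];
  [:: unitE 1 1; unitE 2 3; unitE 3 2; [:: (3, 3, 1%Z); (2, 2, -1%Z)]];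
  [:: unitE 0 1; unitE 0 2; unitE 0 3; unitE 1 1; unitE 1 2; unitE 1 3;
      unitE 2 1; unitE 2 2; unitE 2 3; unitE 3 1; unitE 3 2; unitE 3 3];
  [:: unitE 0 1; unitE 0 2; unitE 1 1; unitE 1 2; unitE 2 1; unitE 2 2;
      unitE 3 3];
  [:: unitE 0 1; unitE 1 1; unitE 2 2; unitE 2 3; unitE 3 2; unitE 3 3];
  [:: unitE 1 1; unitE 1 2; unitE 1 3; unitE 2 1; unitE 2 2; unitE 2 3;
      unitE 3 1; unitE 3 2; unitE 3 3];
  [:: unitE 1 2; unitE 1 3; unitE 2 1; [:: (2, 2, 1%Z); (1, 1, -1%Z)];
      unitE 2 3; unitE 3 3]]%N.

(* When [e] is an idempotent, 2 x (x' y) = (x x') y on A_0 x A_0 x A_1 means   *)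
(* that its eigenvalues on A_1 are 0 and 1/2, and x (x' y) = (x x') y that     *)
(* they are 0 and 1.                                                           *)
Definition J_invariant (i : nat) :=
  let c := icoef 1 (nth [::] J_int i) in
  let od := odd_index 1 in
  (size (nth [::] J_der i),
   [:: iproduct 4 od c false false; iproduct 4 od c false true;
       iproduct 4 od c true true; iaction 4 od c 1; iaction 4 od c 2]).

Definition J_check (i : nat) : bool :=
  let c := icoef 1 (nth [::] J_int i) in
  let od := odd_index 1 in
  [&& isupercommutative 4 od c, ijordan 4 od c, iDer_basis 4 od c (nth [::] J_der i) &
      has id (J_invariant i).2].

Lemma J_checkP : iall 19 J_check.
Proof. by vm_compute. Qed.

Lemma J_invariant_uniq : uniq [seq J_invariant i | i <- iota 0 19].
Proof. by vm_compute. Qed.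

Section JTables.
Variable F : numFieldType.

(** This exposes every listed algebra uniformly as a table with doubled constants [J_int], so that
    the integer checks apply to all i at once. *)
Lemma J_table (i : 'I_19) :
  exists s : seq (nat * nat * nat * F), exists sP : well_graded 1 s,
  J_ F i = table 3 sP /\ forall i' j k,
    table_coef 1 s i' j k = (icoef 1 (nth [::] J_int i) i' j k)%:~R / 2%:R.
Proof.
have two0 : 2%:R != 0 :> F by rewrite pnatr_eq0.
have h2 : 2%:~R / 2%:R = 1 :> F by exact: divff.
have h1 : 1%:~R / 2%:R = 2^-1 :> F by exact: div1r.
suff [s [sP Ji e]] : exists s, exists2 sP : well_graded 1 s,
    J_ F i = table 3 sP & s = half_table F (nth [::] J_int i).
  by exists s, sP; split=> // i' j k; rewrite -icoefE -e.
case: i => -[|[|[|[|[|[|[|[|[|[|[|[|[|[|[|[|[|[|[|//]]]]]]]]]]]]]]]]]]] ?;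
  rewrite /J_ /=; match goal with |- exists s, exists2 sP : _, ?J = _ & _ =>
    let J' := eval red in J in
    match J' with @table _ _ _ ?s ?sP => exists s, sP; first reflexivity end
  end; by rewrite /half_table /= ?h2 ?h1.
Qed.

Lemma J_type i : has_type (J_ F i) 1 3.
Proof. by have [s [sP [-> _]]] := J_table i; exact: table_dim_gr. Qed.

Lemma J_jordan i : jordan_superalgebra (J_ F i).
Proof.
have [s [sP [-> cE]]] := J_table i.
have /and4P[sc jo _ _] := iallP _ _ J_checkP i.
split; first exact: isupercommutativeP cE sc.
exact: ijordanP cE jo.
Qed.

Lemma product_nontriv_nonzero (A : superalgebra F) a b :
  product_nontriv A a b -> nonzero_product A.
Proof. by case=> x [y [_ _ xy]]; exists x, y. Qed.

Lemma action_nontriv_nonzero (A : superalgebra F) k :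
  action_nontriv A k -> nonzero_product A.
Proof.
case=> x [x' [y [_ _ _]]]; have [->|xy] := eqVneq (x ** (x' ** y)) 0.
  by rewrite mul0rn eq_sym => xy; exists (x ** x'), y.
by exists x, (x' ** y).
Qed.

Lemma has_id5 (a b c d e : bool) : has id [:: a; b; c; d; e] = [|| a, b, c, d | e].
Proof. by rewrite /= orbF. Qed.

(** Any of the five boolean invariants, when true, exhibits a nonzero product, and [J_check]
    requires one of them to be true. *)
Lemma J_nonzero i : nonzero_product (J_ F i).
Proof.
have [s [sP [-> cE]]] := J_table i.
have /and4P[_ _ _] := iallP _ _ J_checkP i; rewrite /J_invariant has_id5.
have nzP a b := iproductP 3 sP cE a b.
have nzA k := iactionP 3 sP cE k.
by case/or4P=> [/nzP|/nzP|/nzP|/orP[]/nzA];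
  first [exact: product_nontriv_nonzero | exact: action_nontriv_nonzero].
Qed.

Lemma J_orbit_dim i : orbit_dim (J_ F i) = (16 - size (nth [::] J_der i))%N.
Proof.
have [s [sP [-> cE]]] := J_table i.
have /and4P[_ _ de _] := iallP _ _ J_checkP i.
exact: (iDer_basis_orbit_dim sP cE de).
Qed.

Lemma J_iso_inj i j : sa_iso (J_ F i) (J_ F j) -> i = j.
Proof.
move=> ij; have ji := sa_iso_sym ij.
suff e : J_invariant i = J_invariant j.
  apply/val_inj/eqP; rewrite -(nth_uniq (0%N, [::]) _ _ J_invariant_uniq).
  - by rewrite !(nth_map 0%N) ?size_iota ?nth_iota //= e.
  - by rewrite size_map size_iota; exact: ltn_ord.
  - by rewrite size_map size_iota; exact: ltn_ord.
(* This bound makes the truncated subtraction from 16 injective on the sizes at hand. *)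
have small k : (size (nth [::] J_der k) <= 16)%N.
  by do 19! [case: k => [//|k]]; rewrite nth_default.
have := sa_iso_orbit_dim ij; rewrite !J_orbit_dim => /(congr1 (subn 16)).
rewrite !subKn // /J_invariant => ->; congr pair.
move: ij ji.
have [s [sP [-> cE]]] := J_table i; have [s' [sP' [-> cE']]] := J_table j => ij ji.
have pE a b : iproduct 4 (odd_index 1) (icoef 1 (nth [::] J_int i)) a b =
              iproduct 4 (odd_index 1) (icoef 1 (nth [::] J_int j)) a b.
  by apply/(iproductP 3 sP cE)/(iproductP 3 sP' cE'); exact: sa_iso_product_nontriv.
have aE k : iaction 4 (odd_index 1) (icoef 1 (nth [::] J_int i)) k =
            iaction 4 (odd_index 1) (icoef 1 (nth [::] J_int j)) k.
  by apply/(iactionP 3 sP cE)/(iactionP 3 sP' cE'); exact: sa_iso_action_nontriv.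
by rewrite !pE !aE.
Qed.

End JTables.

(** * Decompositions of the algebras of the list *)

Section Relabel.
Variables (F : fieldType) (m : nat).

Definition irelabel (N : nat) (od : nat -> bool) (c c' : nat -> nat -> nat -> int)
    (f : nat -> nat) : bool :=
  [&& iall N (fun i => (f i < N)%N && (od (f i) == od i)),
      uniq (map f (iota 0 N)) &
      iall N (fun i => iall N (fun j => iall N (fun k =>
        c (f i) (f j) (f k) == c' i j k)))].

Lemma table_relabel n (s s' : seq (nat * nat * nat * F)) (sP : well_graded m s)
    (s'P : well_graded m s') (f : 'I_(m + n) -> 'I_(m + n)) :
    injective f -> (forall i, odd_index m (f i) = odd_index m i) ->
    (forall i j k, table_coef m s (f i) (f j) (f k) = table_coef m s' i j k) ->
  sa_iso (table n s'P) (table n sP).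
Proof.
move=> f_inj fod fc.
apply: (@table_iso _ m n s' s'P (table n sP) (fun i => delta_mx 0 (f i))).
- exact: table_dim.
- move=> x /rowP H i; have := H (f i); rewrite summxE mxE => <-.
  rewrite (bigD1 i) //= !mxE !eqxx mulr1 big1 ?addr0 // => j ji.
  by rewrite !mxE (inj_eq f_inj) eq_sym (negPf ji) andbF mulr0.
- by move=> i; rewrite -fod; exact: delta_gr.
move=> i j; rewrite delta_mul; apply/rowP=> k; rewrite mxE summxE.
have [g fK gK] := injF_bij f_inj.
rewrite (bigD1 (g k)) //= !mxE gK !eqxx mulr1 big1 ?addr0 => [|l lk].
  by rewrite -fc gK.
rewrite !mxE /= [_ == f l]eq_sym (can2_eq fK gK) (negPf lk).
by rewrite mulr0.
Qed.

Lemma dsum_zero_table n n' (s : seq (nat * nat * nat * F)) (sP : well_graded m s)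
    (zP : well_graded 0 ([::] : seq (nat * nat * nat * F))) :
    (forall i j k, (m + n <= i)%N || (m + n <= j)%N || (m + n <= k)%N ->
       table_coef m s i j k = 0) ->
  sa_iso (table (n + n') sP) (dsum (table n sP) (table n' zP)).
Proof.
move=> c0.
(* The first m + n basis vectors go to the left summand, the others to the right one. Outside its
   range [x1] or [x2] gives the zero vector, so the single formula [b] covers both cases. *)
pose x1 (i : nat) : table n sP := \row_(k < m + n) (i == k)%:R.
pose x2 (i : nat) : table n' zP := \row_(k < 0 + n') (i == (m + n + k)%N)%:R.
pose b (i : 'I_(m + (n + n'))) : dsum (table n sP) (table n' zP) := (x1 i, x2 i).
have sum1 (a : 'I_(m + (n + n')) -> F) : (\sum_i a i *: b i).1 = \sum_i a i *: x1 i.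
  by elim/big_rec2: _ => // i y1 y2 _ <-.
have sum2 (a : 'I_(m + (n + n')) -> F) : (\sum_i a i *: b i).2 = \sum_i a i *: x2 i.
  by elim/big_rec2: _ => // i y1 y2 _ <-.
have pick (a : 'I_(m + (n + n')) -> F) (i : 'I_(m + (n + n'))) : (\sum_j a j * (val j == i)%:R) = a i.
  rewrite (bigD1 i) //= eqxx mulr1 big1 ?addr0 // => j ji.
  by rewrite (_ : (val j == i) = false) ?mulr0 //; exact: negPf ji.
apply: (@table_iso _ m (n + n') s sP _ b).
- by rewrite dim_pair !table_dim add0n addnA.
- move=> a a0 i; rewrite -[LHS]pick.
  have [iN|iN] := ltnP i (m + n).
    transitivity ((\sum_j a j *: x1 j) 0 (Ordinal iN)).
      by rewrite summxE; apply: eq_bigr => j _; rewrite !mxE.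
    by rewrite -sum1 a0 mxE.
  have iN' : (i - (m + n) < 0 + n')%N by rewrite ltn_subLR // -addnA.
  transitivity ((\sum_j a j *: x2 j) 0 (Ordinal iN')).
    rewrite summxE; apply: eq_bigr => j _; rewrite !mxE /=.
    by rewrite subnKC.
  by rewrite -sum2 a0 mxE.
- move=> i; rewrite mem_dsum_gr; apply/andP; split; apply/mem_table_gr=> k.
    by rewrite mxE; have [->|] := eqVneq (val i) k; rewrite ?eqxx.
  rewrite mxE => ko; case: eqP => // e.
  by move: ko; rewrite /odd_index e -addnA leq_addr.
move=> i j; rewrite dsum_mulE.
rewrite [RHS]surjective_pairing sum1 sum2; congr pair.
  apply/rowP=> k; have kN : (k < m + (n + n'))%N by rewrite addnA ltn_addr.
  transitivity (table_coef m s i j k); last first.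
    rewrite -[LHS](pick (fun k' => table_coef m s i j k') (Ordinal kN)) summxE.
    by apply: eq_bigr => l _; rewrite !mxE.
  have x10 (i' : nat) : (m + n <= i')%N -> x1 i' = 0.
    move=> ni; apply/rowP=> l; rewrite !mxE; case: eqP => // e.
    by rewrite e leqNgt ltn_ord in ni.
  have x1N (i' : nat) (iN : (i' < m + n)%N) : x1 i' = delta_mx 0 (Ordinal iN).
    by apply/rowP=> l; rewrite !mxE eqxx /= -val_eqE eq_sym.
  rewrite -[LHS]/((x1 i ** x1 j) 0 k).
  have [iN|iN] := leqP (m + n) i; first by rewrite (x10 i) // sa_mul0l mxE c0 ?iN.
  have [jN|jN] := leqP (m + n) j; first by rewrite (x10 j) // sa_mul0r mxE c0 ?jN ?orbT.
  by rewrite !x1N delta_mul mxE.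
apply/rowP=> k; transitivity (0 : F).
  by rewrite table_mulE summxE big1 // => p _; rewrite summxE big1 // => q _;
    rewrite !mxE /table_coef big_nil mulr0.
rewrite summxE big1 // => l _; rewrite !mxE; case: eqP => [e|]; last by rewrite mulr0.
by rewrite c0 ?mul0r // e leq_addr !orbT.
Qed.

End Relabel.

Section Decompositions.
Variable F : numFieldType.

Lemma trivial_iso2 : sa_iso (table 2 (isT : well_graded 0 ([::] : seq (nat * nat * nat * F))))
  (dsum (S_1_1 F) (S_1_1 F)).
Proof.
apply: (@dsum_zero_table F 0 1 1 [::] isT isT) => i j k _.
by rewrite /table_coef big_nil.
Qed.

Lemma trivial_iso3 : sa_iso (table 3 (isT : well_graded 0 ([::] : seq (nat * nat * nat * F))))
  (dsum (S_1_1 F) (dsum (S_1_1 F) (S_1_1 F))).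
Proof.
apply: sa_iso_trans (dsum_isor _ trivial_iso2).
apply: (@dsum_zero_table F 0 1 2 [::] isT isT) => i j k _.
by rewrite /table_coef big_nil.
Qed.

Definition iplain (N : nat) (t : seq (nat * nat * nat * int)) : bool :=
  all (fun x => [&& x.1.1.1 < N, x.1.1.2 < N & x.1.2 < N]%N) t.

Lemma iplainP m N t i j k : iplain N t -> (N <= i)%N || (N <= j)%N || (N <= k)%N ->
  icoef m t i j k = 0.
Proof.
elim: t => [//|[[[i' j'] k'] a] t IHt] /= /andP[/and3P[iN jN kN] tN] H.
rewrite IHt // add0r; case: eqP => [[ei ej ek]|_].
  by move: H; rewrite ei ej ek leqNgt iN leqNgt jN leqNgt kN.
case: eqP => // -[ej ei ek].
by move: H; rewrite ei ej ek leqNgt jN leqNgt iN leqNgt kN.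
Qed.

(** The list l gives, for each basis vector of the algebra to be decomposed, its position in the
    basis of the first summand followed by the null odd vectors. *)
Definition iperm (l : seq nat) (i : nat) : nat := nth 0%N l i.

Lemma table_decomposition n n' (t t' : seq (nat * nat * nat * int))
    (s s' : seq (nat * nat * nat * F)) (sP : well_graded 1 s) (s'P : well_graded 1 s')
    (B : superalgebra F) (l : seq nat) (zP : well_graded 0 ([::] : seq (nat * nat * nat * F))) :
    (forall i j k, table_coef 1 s i j k = (icoef 1 t i j k)%:~R / 2%:R) ->
    (forall i j k, table_coef 1 s' i j k = (icoef 1 t' i j k)%:~R / 2%:R) ->
    sa_iso (table n' zP) B ->
    iplain (1 + n) t ->
    irelabel (1 + (n + n')) (odd_index 1) (icoef 1 t) (icoef 1 t') (iperm l) ->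
  sa_iso (table (n + n') s'P) (dsum (table n sP) B).
Proof.
move=> cE c'E zB tN /and3P[/iallP lN luniq /iallP lc].
apply: sa_iso_trans (dsum_isor _ zB); apply: sa_iso_trans; last first.
  apply: dsum_zero_table => i j k H; rewrite cE (iplainP _ tN H).
  exact: mul0r.
have lN' (i : 'I_(1 + (n + n'))) : (iperm l i < 1 + (n + n'))%N.
  by have /andP[] := lN i.
apply: (@table_relabel _ _ _ _ _ _ _ (fun i => Ordinal (lN' i))) => [i j|i|i j k].
- move=> /(congr1 val)/= e; apply/val_inj/eqP.
  by rewrite -(nth_uniq 0%N _ _ luniq) ?size_map ?size_iota ?ltn_ord //
    !(nth_map 0%N) ?size_iota ?ltn_ord // !nth_iota ?ltn_ord // e.
- by have /andP[_ /eqP] := lN i.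
- by rewrite cE c'E; have /iallP/(_ j)/iallP/(_ k)/eqP-> := lc i.
Qed.

Let h2 : 2%:~R / 2%:R = 1 :> F. Proof. by apply: divff; rewrite pnatr_eq0. Qed.
Let h1 : 1%:~R / 2%:R = 2^-1 :> F. Proof. exact: div1r. Qed.

Local Ltac half_coefs :=
  move=> ? ? ?; rewrite -icoefE; congr (table_coef _ _ _ _ _);
  by rewrite /half_table /= ?h2 ?h1.

Local Ltac decompose n n' t t' l iso :=
  apply: (@table_decomposition n n' t t' _ _ _ _ _ l isT _ _ iso);
  [half_coefs | half_coefs | by vm_compute | by vm_compute].

Definition U_1_int : seq (nat * nat * nat * int) := [:: (0, 0, 0, 2%Z)]%N.
Definition S_2_int : seq (seq (nat * nat * nat * int)) := [::
  [:: (0, 0, 0, 2%Z); (0, 1, 1, 1%Z)];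
  [:: (0, 0, 0, 2%Z); (0, 1, 1, 2%Z)]]%N.
Definition S_3_int : seq (seq (nat * nat * nat * int)) := [::
  [:: (0, 1, 2, 2%Z); (1, 2, 0, 2%Z)];
  [:: (1, 2, 0, 2%Z)];
  [:: (0, 1, 2, 2%Z)];
  [:: (0, 0, 0, 2%Z); (0, 1, 1, 2%Z); (0, 2, 2, 1%Z)];
  [:: (0, 0, 0, 2%Z); (0, 1, 1, 1%Z); (0, 2, 2, 1%Z)];
  [:: (0, 0, 0, 2%Z); (0, 1, 1, 2%Z); (0, 2, 2, 2%Z)];
  [:: (0, 0, 0, 2%Z); (0, 1, 1, 1%Z); (0, 2, 2, 1%Z); (1, 2, 0, 2%Z)];
  [:: (0, 0, 0, 2%Z); (0, 1, 1, 2%Z); (0, 2, 2, 2%Z); (1, 2, 0, 2%Z)]]%N.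

Let S11 := sa_iso_refl (S_1_1 F).

Lemma J_1_iso : sa_iso (J_1 F) (dsum (S_2_3 F) (S_1_1 F)).
Proof.
decompose 2%N 1%N (nth [::] S_3_int 1) (nth [::] J_int 0) [:: 0; 1; 2; 3]%N S11.
Qed.

Lemma J_2_iso : sa_iso (J_2 F) (dsum (S_3_3 F) (S_1_1 F)).
Proof.
decompose 2%N 1%N (nth [::] S_3_int 2) (nth [::] J_int 1) [:: 0; 1; 2; 3]%N S11.
Qed.

Lemma J_3_iso : sa_iso (J_3 F) (dsum (S_1_3 F) (S_1_1 F)).
Proof.
decompose 2%N 1%N (nth [::] S_3_int 0) (nth [::] J_int 2) [:: 0; 1; 2; 3]%N S11.
Qed.

Lemma J_10_iso : sa_iso (J_10 F) (dsum (S_5_3 F) (S_1_1 F)).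
Proof.
decompose 2%N 1%N (nth [::] S_3_int 4) (nth [::] J_int 9) [:: 0; 3; 1; 2]%N S11.
Qed.

Lemma J_11_iso : sa_iso (J_11 F) (dsum (S_7_3 F) (S_1_1 F)).
Proof.
decompose 2%N 1%N (nth [::] S_3_int 6) (nth [::] J_int 10) [:: 0; 3; 1; 2]%N S11.
Qed.

Lemma J_12_iso : sa_iso (J_12 F) (dsum (S_4_3 F) (S_1_1 F)).
Proof.
decompose 2%N 1%N (nth [::] S_3_int 3) (nth [::] J_int 11) [:: 0; 3; 2; 1]%N S11.
Qed.

Lemma J_13_iso : sa_iso (J_13 F) (dsum (S_6_3 F) (S_1_1 F)).
Proof.
decompose 2%N 1%N (nth [::] S_3_int 5) (nth [::] J_int 12) [:: 0; 3; 1; 2]%N S11.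
Qed.

Lemma J_14_iso : sa_iso (J_14 F) (dsum (S_8_3 F) (S_1_1 F)).
Proof.
decompose 2%N 1%N (nth [::] S_3_int 7) (nth [::] J_int 13) [:: 0; 3; 1; 2]%N S11.
Qed.

Lemma J_7_iso : sa_iso (J_7 F) (dsum (U_1 F) (dsum (S_1_1 F) (dsum (S_1_1 F) (S_1_1 F)))).
Proof.
decompose 0%N 3%N U_1_int (nth [::] J_int 6) [:: 0; 1; 2; 3]%N trivial_iso3.
Qed.

Lemma J_8_iso : sa_iso (J_8 F) (dsum (S_1_2 F) (dsum (S_1_1 F) (S_1_1 F))).
Proof.
decompose 1%N 2%N (nth [::] S_2_int 0) (nth [::] J_int 7) [:: 0; 3; 2; 1]%N trivial_iso2.
Qed.

Lemma J_9_iso : sa_iso (J_9 F) (dsum (S_2_2 F) (dsum (S_1_1 F) (S_1_1 F))).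
Proof.
decompose 1%N 2%N (nth [::] S_2_int 1) (nth [::] J_int 8) [:: 0; 3; 2; 1]%N trivial_iso2.
Qed.

Lemma indecomposable_half_table n (s : seq (nat * nat * nat * F)) (sP : well_graded 1 s) t :
    (forall i j k, table_coef 1 s i j k = (icoef 1 t i j k)%:~R / 2%:R) ->
    iannihilator_trivial (1 + n) (odd_index 1) (icoef 1 t) ->
  indecomposable (table n sP).
Proof. by move=> cE; exact: iannihilator_trivialP cE erefl. Qed.

Local Ltac indecomp n t :=
  apply: (@indecomposable_half_table n _ _ t); [half_coefs | by vm_compute].

Lemma U_1_indec : indecomposable (U_1 F).
Proof. indecomp 0%N U_1_int. Qed.

Lemma S_1_1_indec : indecomposable (S_1_1 F).
Proof. by apply: indecomposable_dim1; rewrite table_dim. Qed.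

Lemma S_1_2_indec : indecomposable (S_1_2 F).
Proof. indecomp 1%N (nth [::] S_2_int 0). Qed.

Lemma S_2_2_indec : indecomposable (S_2_2 F).
Proof. indecomp 1%N (nth [::] S_2_int 1). Qed.

Lemma S_1_3_indec : indecomposable (S_1_3 F).
Proof. indecomp 2%N (nth [::] S_3_int 0). Qed.

Lemma S_2_3_indec : indecomposable (S_2_3 F).
Proof. indecomp 2%N (nth [::] S_3_int 1). Qed.

Lemma S_3_3_indec : indecomposable (S_3_3 F).
Proof. indecomp 2%N (nth [::] S_3_int 2). Qed.

Lemma S_4_3_indec : indecomposable (S_4_3 F).
Proof. indecomp 2%N (nth [::] S_3_int 3). Qed.

Lemma S_5_3_indec : indecomposable (S_5_3 F).
Proof. indecomp 2%N (nth [::] S_3_int 4). Qed.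

Lemma S_6_3_indec : indecomposable (S_6_3 F).
Proof. indecomp 2%N (nth [::] S_3_int 5). Qed.

Lemma S_7_3_indec : indecomposable (S_7_3 F).
Proof. indecomp 2%N (nth [::] S_3_int 6). Qed.

Lemma S_8_3_indec : indecomposable (S_8_3 F).
Proof. indecomp 2%N (nth [::] S_3_int 7). Qed.

Lemma J_4_indec : indecomposable (J_4 F).
Proof. indecomp 3%N (nth [::] J_int 3). Qed.

Lemma J_5_indec : indecomposable (J_5 F).
Proof. indecomp 3%N (nth [::] J_int 4). Qed.

Lemma J_6_indec : indecomposable (J_6 F).
Proof. indecomp 3%N (nth [::] J_int 5). Qed.

Lemma J_15_indec : indecomposable (J_15 F).
Proof. indecomp 3%N (nth [::] J_int 14). Qed.

Lemma J_16_indec : indecomposable (J_16 F).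
Proof. indecomp 3%N (nth [::] J_int 15). Qed.

Lemma J_17_indec : indecomposable (J_17 F).
Proof. indecomp 3%N (nth [::] J_int 16). Qed.

Lemma J_18_indec : indecomposable (J_18 F).
Proof. indecomp 3%N (nth [::] J_int 17). Qed.

Lemma J_19_indec : indecomposable (J_19 F).
Proof. indecomp 3%N (nth [::] J_int 18). Qed.

End Decompositions.

(** * Classification *)

Section Independence.
Variables (F : fieldType) (V : vectType F).
Implicit Types (x y z : V) (a b c : F).

Definition indep3 x y z : Prop :=
  forall a b c, a *: x + b *: y + c *: z = 0 -> [/\ a = 0, b = 0 & c = 0].

Lemma free_indep3 x y z : free [:: x; y; z] -> indep3 x y z.
Proof.
move=> /(@freeP _ _ 3 [tuple x; y; z]) H a b c e.
have := H (fun i => [:: a; b; c]`_i); rewrite !big_ord_recl big_ord0 /= addr0 addrA.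
move=> /(_ e) {}H; split; [exact: H ord0 | exact: H (lift ord0 ord0) |].
exact: H (lift ord0 (lift ord0 ord0)).
Qed.

Lemma indep3_span (U : {vspace V}) x y z : \dim U = 3%N ->
  x \in U -> y \in U -> z \in U -> indep3 x y z ->
  forall u, u \in U -> exists a b c, u = a *: x + b *: y + c *: z.
Proof.
move=> U3 Ux Uy Uz ind u Uu.
have fX : free [tuple x; y; z].
  apply/freeP=> k; rewrite !big_ord_recl big_ord0 /= addr0 addrA => /ind[k0 k1 k2].
  by case=> -[|[|[|//]]] i; [rewrite -k0|rewrite -k1|rewrite -k2]; congr k; apply/val_inj.
have UX : U = <<[tuple x; y; z]>>%VS.
  apply/eqP; rewrite eq_sym eqEdim U3 (eqP fX) leqnn andbT.
  by apply/span_subvP=> v; rewrite !inE => /or3P[] /eqP->.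
move: Uu; rewrite UX => /coord_span; rewrite !big_ord_recl big_ord0 /= addr0 addrA.
by move=> ->; do 3!eexists.
Qed.

Lemma indep3_scale a b c x y z : a != 0 -> b != 0 -> c != 0 ->
  indep3 x y z -> indep3 (a *: x) (b *: y) (c *: z).
Proof.
move=> a0 b0 c0 ind a' b' c'; rewrite !scalerA => /ind[].
by move=> /eqP + /eqP + /eqP; rewrite !mulf_eq0 (negPf a0) (negPf b0) (negPf c0) !orbF
  => /eqP-> /eqP-> /eqP->.
Qed.

Lemma indep3_shearl a b x y z : indep3 x y z -> indep3 (x + a *: y + b *: z) y z.
Proof.
move=> ind a' b' c' e.
have [|-> ] := ind a' (a' * a + b') (a' * b + c').
  rewrite -[RHS]e !scalerDr !scalerDl !scalerA.
  by rewrite -!addrA; congr (_ + (_ + _)); rewrite addrCA.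
by rewrite !mul0r !add0r.
Qed.

Lemma indep3_shearr a b x y z : indep3 x y z -> indep3 x y (a *: x + b *: y + z).
Proof.
move=> ind a' b' c' e.
have [|h1 h2 h3] := ind (a' + c' * a) (b' + c' * b) c'.
  rewrite -[RHS]e !scalerDr !scalerDl !scalerA.
  by rewrite -!addrA; congr (_ + _); rewrite addrCA; congr (_ + _); rewrite addrCA.
by move: h1 h2; rewrite h3 !mul0r !addr0.
Qed.

Lemma exists_notin (U W : {vspace V}) : (\dim W < \dim U)%N ->
  exists2 z, z \in U & z \notin W.
Proof.
move=> dWU; apply/subvPn; apply: contraL dWU => /dimvS.
by rewrite -leqNgt.
Qed.

Lemma dim1_vline (U : {vspace V}) : \dim U = 1%N -> exists2 v, v != 0 & U = <[v]>%VS.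
Proof.
move=> U1; exists (vpick U); first by rewrite vpick0 -dimv_eq0 U1.
apply/eqP; rewrite eq_sym eqEdim -memvE memv_pick U1 dim_vline vpick0 -dimv_eq0 U1.
by [].
Qed.

End Independence.

(** * Recognising a table from a basis of the odd part *)

Section OddBasis.
Variables (F : numFieldType) (A : superalgebra F).
Variables (s : seq (nat * nat * nat * F)) (sP : well_graded 1 s).
Local Notation c := (table_coef 1 s).

(** Seven products suffice: the grading kills the missing coordinates, supercommutativity of both
    algebras gives the reversed products, and odd squares vanish since 2 is invertible. *)
Lemma odd_basis_iso (e f1 f2 f3 : A) :
    has_type A 1 3 -> supercommutative A -> supercommutative (table 3 sP) ->
    e \in sa_gr A false -> e != 0 ->
    f1 \in sa_gr A true -> f2 \in sa_gr A true -> f3 \in sa_gr A true ->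
    indep3 f1 f2 f3 ->
    e ** e = c 0 0 0 *: e ->
    e ** f1 = c 0 1 1 *: f1 + c 0 1 2 *: f2 + c 0 1 3 *: f3 ->
    e ** f2 = c 0 2 1 *: f1 + c 0 2 2 *: f2 + c 0 2 3 *: f3 ->
    e ** f3 = c 0 3 1 *: f1 + c 0 3 2 *: f2 + c 0 3 3 *: f3 ->
    f1 ** f2 = c 1 2 0 *: e -> f1 ** f3 = c 1 3 0 *: e -> f2 ** f3 = c 2 3 0 *: e ->
  sa_iso A (table 3 sP).
Proof.
move=> [A0 A1] scA scT Ae e0 Af1 Af2 Af3 ind ee ef1 ef2 ef3 f12 f13 f23.
pose b (i : 'I_(1 + 3)) := nth 0 [:: e; f1; f2; f3] i.
have bgr i : b i \in sa_gr A (odd_index 1 i) by case: i => -[|[|[|[|//]]]].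
apply: sa_iso_sym; apply: (@table_iso _ 1 3 s sP A b) => //.
- by rewrite -sa_dim A0 A1.
- move=> x; rewrite !big_ord_recl big_ord0 addr0 /b /= => H.
  have ev : x ord0 *: e = 0.
    apply: sa_gr_cap; first exact: rpredZ.
    move: H => /eqP; rewrite addr_eq0 => /eqP->; rewrite rpredN.
    by rewrite !rpredD ?rpredZ.
  move: H; rewrite ev add0r addrA => /ind[x1 x2 x3].
  move/eqP: ev; rewrite scaler_eq0 (negPf e0) orbF => /eqP x0.
  by case=> -[|[|[|[|//]]]] i; [rewrite -x0|rewrite -x1|rewrite -x2|rewrite -x3];
    congr x; apply/val_inj.
have csc (i j k : 'I_4) : c i j k = (-1) ^+ (odd_index 1 i * odd_index 1 j) * c j i k.
  have := scT _ _ _ _ (delta_gr sP i) (delta_gr sP j); rewrite !delta_mul.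
  by move=> /rowP/(_ k); rewrite !mxE.
pose S i j := \sum_(k < 1 + 3) c i j k *: b k.
have Ssc (i j : 'I_4) : S i j = (-1) ^+ (odd_index 1 i * odd_index 1 j) *: S j i.
  by rewrite /S scaler_sumr; apply: eq_bigr => k _; rewrite scalerA -csc.
have swap (i j : 'I_4) : b i ** b j = S i j -> b j ** b i = S j i.
  by move=> bij; rewrite (scA _ _ _ _ (bgr j) (bgr i)) bij [RHS]Ssc.
have diag (i : 'I_4) : (0 < i)%N -> b i ** b i = S i i.
  move=> i0; have z (x : A) : x = (-1) ^+ (odd_index 1 i * odd_index 1 i) *: x -> x = 0.
    rewrite /odd_index i0 expr1 scaleN1r => /eqP; rewrite -addr_eq0 -mulr2n.
    by rewrite -scaler_nat scaler_eq0 pnatr_eq0 => /eqP.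
  rewrite (z _ (scA _ _ _ _ (bgr i) (bgr i))).
  by rewrite (z _ (Ssc i i)).
have SE i j : S i j = c i j 0%N *: e + (c i j 1%N *: f1 + c i j 2%N *: f2 + c i j 3%N *: f3).
  by rewrite /S !big_ord_recl big_ord0 addr0 /= !addrA.
have c0 i j k : odd_index 1 k != odd_index 1 i (+) odd_index 1 j -> c i j k = 0.
  exact: table_coef0 sP _ _ _.
pose o (i : nat) (i4 : (i < 4)%N) : 'I_4 := Ordinal i4.
have P00 : b (o 0%N isT) ** b (o 0%N isT) = S 0%N 0%N.
  by rewrite SE ![c 0%N 0%N _.+1]c0 // !scale0r !addr0.
have P01 : b (o 0%N isT) ** b (o 1%N isT) = S 0%N 1%N by rewrite SE (c0 _ _ 0%N) // scale0r add0r.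
have P02 : b (o 0%N isT) ** b (o 2%N isT) = S 0%N 2%N by rewrite SE (c0 _ _ 0%N) // scale0r add0r.
have P03 : b (o 0%N isT) ** b (o 3%N isT) = S 0%N 3%N by rewrite SE (c0 _ _ 0%N) // scale0r add0r.
have P12 : b (o 1%N isT) ** b (o 2%N isT) = S 1%N 2%N.
  by rewrite SE ![c 1%N 2%N _.+1]c0 // !scale0r !addr0.
have P13 : b (o 1%N isT) ** b (o 3%N isT) = S 1%N 3%N.
  by rewrite SE ![c 1%N 3%N _.+1]c0 // !scale0r !addr0.
have P23 : b (o 2%N isT) ** b (o 3%N isT) = S 2%N 3%N.
  by rewrite SE ![c 2%N 3%N _.+1]c0 // !scale0r !addr0.
have P10 := swap _ _ P01; have P20 := swap _ _ P02; have P30 := swap _ _ P03.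
have P21 := swap _ _ P12; have P31 := swap _ _ P13; have P32 := swap _ _ P23.
have P11 := diag (o 1%N isT) isT; have P22 := diag (o 2%N isT) isT.
have P33 := diag (o 3%N isT) isT.
by case=> -[|[|[|[|//]]]] ? [[|[|[|[|//]]]] ?].
Qed.

End OddBasis.

(** * The operator L and the form w under the Jordan identity *)

Section Classification.
Variables (F : numClosedFieldType) (A : superalgebra F).
Hypothesis typeA : has_type A 1 3.
Hypothesis scA : supercommutative A.
Hypothesis jA : jordan_identity A.

Section Fixed.
Variable e : A.
Hypothesis e0 : e != 0.
Hypothesis Ae : sa_gr A false = <[e]>%VS.
Variable lam : F.
Hypothesis ee : e ** e = lam *: e.
Implicit Types (u v w x y z : A) (a b c : F).
Local Notation odd_el u := (u \in sa_gr A true).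

Let e_even : e \in sa_gr A false. Proof. by rewrite Ae memv_line. Qed.

Definition form u v : F := coord [tuple e] ord0 (u ** v).

Lemma formE u v : odd_el u -> odd_el v -> u ** v = form u v *: e.
Proof.
move=> Au Av; have : u ** v \in <<[tuple e]>>%VS.
  by rewrite span_seq1 -Ae; exact: (sa_graded Au Av).
by move/coord_span; rewrite big_ord1.
Qed.

Lemma form_unique u v a : u ** v = a *: e -> form u v = a.
Proof.
move=> uv; have /(@freeP _ _ 1 [tuple e]) fe : free [:: e] by rewrite seq1_free.
by rewrite /form uv linearZ /= (coord_free ord0 ord0) ?eqxx ?mulr1 // seq1_free.
Qed.

Lemma formDl u v w : form (u + v) w = form u w + form v w.
Proof. by rewrite /form sa_mulDl linearD. Qed.
Lemma formDr u v w : form w (u + v) = form w u + form w v.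
Proof. by rewrite /form sa_mulDr linearD. Qed.
Lemma formZl a u v : form (a *: u) v = a * form u v.
Proof. by rewrite /form sa_mulZl linearZ. Qed.
Lemma formZr a u v : form u (a *: v) = a * form u v.
Proof. by rewrite /form sa_mulZr linearZ. Qed.
Lemma form0r v : form v 0 = 0.
Proof. by rewrite /form sa_mul0r linear0. Qed.

Lemma mul_oddC u v : odd_el u -> odd_el v -> u ** v = - (v ** u).
Proof. by move=> Au Av; rewrite (scA Au Av) expr1 scaleN1r. Qed.

Lemma mul_eC u : odd_el u -> u ** e = e ** u.
Proof. by move=> Au; rewrite (scA Au e_even) expr0 scale1r. Qed.

Lemma formC u v : odd_el u -> odd_el v -> form u v = - form v u.
Proof. by move=> Au Av; apply: form_unique; rewrite mul_oddC // formE // scaleNr. Qed.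

Lemma form_diag u : odd_el u -> form u u = 0.
Proof.
move=> Au; have /eqP := formC Au Au; rewrite -addr_eq0 -mulr2n.
by rewrite mulrn_eq0 => /eqP.
Qed.

Lemma odd_L u : odd_el u -> odd_el (e ** u).
Proof. exact: (sa_graded e_even). Qed.

(** The suffix of this lemma and of the three similar ones below lists the arguments x, y, z, t put
    into the Jordan identity. *)
Lemma jordan_eeev v : odd_el v ->
  lam ^+ 2 *: (e ** v) + 2%:R *: (e ** (e ** (e ** v))) = (3%:R * lam) *: (e ** (e ** v)).
Proof.
move=> Av; have := jA e_even e_even e_even Av.
rewrite /= !expr0 !scale1r !(ee, sa_mulZl) !mul_eC ?odd_L //.
rewrite !(sa_mulZr, sa_mulZl) !mul_eC ?odd_L // scalerA -expr2 -addrA -mulr2n => H.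
rewrite scaler_nat H -mulr_natl -!scalerDl; congr (_ *: _); ring.
Qed.

Lemma e_inj a b : a *: e = b *: e -> a = b.
Proof.
by move/eqP; rewrite -subr_eq0 -scalerBl scaler_eq0 (negPf e0) orbF subr_eq0 => /eqP.
Qed.

Let L u := e ** u.

Let LZ a u : L (a *: u) = a *: L u. Proof. exact: sa_mulZr. Qed.

Lemma jordan_ueve u v : odd_el u -> odd_el v ->
  2%:R * lam * form (L u) v - lam * form (L v) u
    = 2%:R * form (L u) (L v) + lam ^+ 2 * form u v.
Proof.
move=> Au Av; have := jA Au e_even Av e_even.
rewrite /= !expr0 !expr1 !scale1r !scaleN1r !(ee, sa_mulZl, sa_mulZr).
rewrite !(mul_eC Au) !(mul_eC Av) (formE (odd_L Au) Av) (formE (odd_L Av) Au).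
rewrite (formE (odd_L Au) (odd_L Av)) (formE Au Av) !(ee, sa_mulZl, sa_mulZr).
rewrite !scalerA -scaleNr -!scalerDl => /e_inj H.
transitivity (form (e ** u) v * lam + form (e ** u) v * lam - lam * form (e ** v) u).
  by rewrite /L; ring.
by rewrite H /L; ring.
Qed.

Lemma jordan_uvwe u v w : odd_el u -> odd_el v -> odd_el w ->
  form (L v) w *: L u - form (L u) w *: L v
    = form v w *: L (L u) - form u w *: L (L v).
Proof.
move=> Au Av Aw; have := jA Au Av Aw e_even.
rewrite /= !expr0 !expr1 ?scale1r !scaleN1r.
rewrite (_ : (-1) ^+ (true * true + true * true + true * false + true * false)%N = 1);
  last by rewrite expr2; ring.
rewrite scale1r (mul_eC Au) (mul_eC Av) (mul_eC Aw) (formE (odd_L Au) Aw).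
rewrite (formE (odd_L Av) Aw) (formE Au Av) (formE Au Aw) (formE Av Aw).
rewrite !sa_mulZl !sa_mulZr !mul_eC ?odd_L // -/(L u) -/(L v) -/(L w) => H.
by move: H; rewrite -!addrA => /addrI; rewrite addrC.
Qed.

Lemma jordan_uvew u v w : odd_el u -> odd_el v -> odd_el w ->
  form u v *: (L (L w) - lam *: L w) - form u w *: (L (L v) - lam *: L v)
    + form v w *: (L (L u) - lam *: L u) = 0.
Proof.
move=> Au Av Aw; have := jA Au Av e_even Aw.
rewrite /= !expr0 !expr1 ?scale1r !scaleN1r.
rewrite (_ : (-1) ^+ (true * true + true * false + true * true + false * true)%N = 1);
  last by rewrite expr2; ring.
rewrite scale1r (mul_eC Au) (mul_eC Av) (formE Au Av) (formE Au Aw) (formE Av Aw).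
rewrite !(sa_mulZl, sa_mulZr, ee) (mul_eC (odd_L Au)) -/(L u) -/(L v) -/(L w) => H.
rewrite !scalerBr opprD [X in X + _]addrACA -opprD addrACA -opprD.
by rewrite -[X in X - _]H subrr.
Qed.

Let half : F := 2%:R^-1.
Let two0 : 2%:R != 0 :> F. Proof. by rewrite pnatr_eq0. Qed.

(** As the form is alternating, [jordan_ueve] becomes (2a - 1)(1 - b) w(u, v) = 0 on eigenvectors;
    the hypothesis is this factor expanded. *)
Lemma form_eigen0 a b u v : lam = 1 -> odd_el u -> odd_el v ->
  L u = a *: u -> L v = b *: v -> 2%:R * a + b - 2%:R * a * b - 1 != 0 ->
  form u v = 0.
Proof.
move=> l1 Au Av Lu Lv ab; have := jordan_ueve Au Av.
rewrite l1 Lu Lv !(formZl, formZr) (formC Av Au) => H.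
suff /eqP : (2%:R * a + b - 2%:R * a * b - 1) * form u v = 0.
  by rewrite mulf_eq0 (negPf ab) => /eqP.
transitivity (2%:R * 1 * (a * form u v) - 1 * (b * - form u v)
  - (2%:R * (a * (b * form u v)) + 1 ^+ 2 * form u v)); first by ring.
by rewrite H subrr.
Qed.

(** On these eigenvectors [jordan_uvwe] becomes (a - b) b w(v, w) u = 0. *)
Lemma form_eigen_other a b u v w : odd_el u -> odd_el v -> odd_el w -> u != 0 ->
  L u = b *: u -> L v = a *: v -> L w = a *: w -> form u w = 0 ->
  b != 0 -> a != b -> form v w = 0.
Proof.
move=> Au Av Aw u0 Lu Lv Lw uw b0 ab; have := jordan_uvwe Au Av Aw.
rewrite Lv Lu !LZ Lu !formZl uw mulr0 scale0r !scale0r !subr0.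
rewrite !scalerA => /eqP; rewrite -subr_eq0 -scalerBl scaler_eq0 (negPf u0) orbF.
rewrite (_ : _ - _ = (a - b) * b * form v w); last by ring.
by rewrite !mulf_eq0 subr_eq0 (negPf ab) (negPf b0) => /eqP.
Qed.

(** L^2 - L is the scalar -1/4 here, so [jordan_uvew] is a linear relation between u, v and w whose
    coefficients are nonzero multiples of the values of the form. *)
Lemma form_half u v w : lam = 1 -> odd_el u -> odd_el v -> odd_el w ->
  L u = half *: u -> L v = half *: v -> L w = half *: w -> indep3 u v w ->
  [/\ form u v = 0, form u w = 0 & form v w = 0].
Proof.
move=> l1 Au Av Aw Lu Lv Lw ind; have := jordan_uvew Au Av Aw.
have h x : L x = half *: x -> L (L x) - lam *: L x = (half * half - half) *: x.
  by move=> Lx; rewrite Lx LZ Lx l1 scale1r scalerA -scalerBl.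
rewrite !h // !scalerA -scaleNr addrC [_ *: w + _]addrC addrA.
have q0 : half * half - half != 0 :> F.
  rewrite (_ : _ - _ = - (half * half)); last by rewrite /half; field.
  by rewrite oppr_eq0 mulf_neq0 // invr_eq0.
by move=> /ind[] /eqP + /eqP + /eqP; rewrite oppr_eq0 !mulf_eq0 (negPf q0) !orbF
  => /eqP-> /eqP-> /eqP->.
Qed.

(** A nonzero alternating form in dimension 3 has rank 2: normalise a hyperbolic pair and move a
    third vector into the radical. *)
Lemma symplectic_basis u v : odd_el u -> odd_el v -> form u v != 0 ->
  exists f1 f2 f3, [/\ odd_el f1, odd_el f2, odd_el f3 & indep3 f1 f2 f3] /\
    [/\ form f1 f2 = 1, form f1 f3 = 0 & form f2 f3 = 0].
Proof.
move=> Au Av uv; have [f1 Af1 w1v] : exists2 f1, odd_el f1 & form f1 v = 1.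
  by exists ((form u v)^-1 *: u); [exact: rpredZ | rewrite formZl mulVf].
have wv1 : form v f1 = -1 by rewrite formC // w1v.
have [z Az z12] : exists2 z, odd_el z & z \notin <<[:: f1; v]>>%VS.
  by apply: exists_notin; rewrite typeA.2 (leq_ltn_trans (dim_span _)).
(* The correction of z by f1 and v makes it orthogonal to both. *)
pose f3 := (- form z v) *: f1 + form z f1 *: v + z.
have Af3 : odd_el f3 by rewrite !rpredD ?rpredZ.
have w13 : form f1 f3 = 0.
  rewrite !formDr !formZr form_diag // w1v mulr0 add0r mulr1.
  by rewrite (formC Af1 Az) subrr.
have w23 : form v f3 = 0.
  rewrite !formDr !formZr form_diag // wv1 mulr0 addr0 mulrN1 opprK.
  by rewrite (formC Av Az) subrr.
have f30 : f3 != 0.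
  apply: contra z12; rewrite /f3 addrC addr_eq0 => /eqP->.
  by rewrite rpredN rpredD ?rpredZ ?memv_span // !inE eqxx ?orbT.
exists f1, v, f3; move: f3 Af3 w13 w23 f30 => f3 Af3 w13 w23 f30.
split; split=> // a b c abc.
have b0 : b = 0.
  have := congr1 (form f1) abc; rewrite !formDr !formZr form_diag // w1v w13 form0r.
  by rewrite !mulr0 mulr1 add0r addr0.
have a0 : a = 0.
  have := congr1 (form v) abc; rewrite !formDr !formZr form_diag // wv1 w23 form0r.
  by rewrite !mulr0 !addr0 mulrN1 => /eqP; rewrite oppr_eq0 => /eqP.
split=> //; move/eqP: abc; rewrite a0 b0 !scale0r !add0r scaler_eq0 (negPf f30).
by rewrite orbF => /eqP.
Qed.

Definition classified : Prop := exists i : 'I_19, sa_iso A (J_ F i).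

(** Here i counts from 0, as in [J_]. Oddness, independence and the seven products of the proposed
    basis are left to prove. *)
Local Ltac J_basis i f1 f2 f3 :=
  exists (@Ordinal 19 i isT); rewrite /J_ /=;
  apply: (@odd_basis_iso F A _ _ e f1 f2 f3 typeA scA
            (J_jordan F (@Ordinal 19 i isT)).1 e_even e0);
  rewrite /table_coef ?big_cons ?big_nil /= ?(add0r, addr0, scale0r, scale1r).

(** * The case where e has square zero *)

Lemma classify_zero : lam = 0 -> (forall u, odd_el u -> L u = 0) ->
  nonzero_product A -> classified.
Proof.
move=> l0 Lz nz.
(* If w were zero, splitting the factors into even and odd parts would show that every product is
   zero. *)
have [u [v [Au Av uv]]] : exists u v, [/\ odd_el u, odd_el v & form u v != 0].
  apply: contrapT => no; case: nz => x [y /eqP[]].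
  have even_e x' : x' \in sa_gr A false -> exists a, x' = a *: e.
    by rewrite Ae => /vlineP.
  have [x0 /even_e[a xa] [x1 Ax1 xE]] : exists2 x0, x0 \in sa_gr A false &
    exists2 x1, odd_el x1 & x = x0 + x1 by apply/memv_addP; rewrite sa_span memvf.
  have [y0 /even_e[b yb] [y1 Ay1 yE]] : exists2 y0, y0 \in sa_gr A false &
    exists2 y1, odd_el y1 & y = y0 + y1 by apply/memv_addP; rewrite sa_span memvf.
  rewrite xE yE xa yb !(sa_mulDl, sa_mulDr, sa_mulZl, sa_mulZr) ee l0 mul_eC //.
  rewrite -!/(L _) !Lz // !scale0r !scaler0 !add0r formE //.
  have -> : form x1 y1 = 0.
    by apply/eqP/negPn/negP => xy; apply: no; exists x1, y1.
  by rewrite scale0r.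
have [f1 [f2 [f3 [[Af1 Af2 Af3 ind] [w12 w13 w23]]]]] := symplectic_basis Au Av uv.
by J_basis 0%N f1 f2 f3; rewrite ?ee ?l0 ?scale0r -?/(L _) ?Lz //;
  rewrite formE // ?w12 ?w13 ?w23 ?scale1r ?scale0r.
Qed.

(** Since L^2 = 0, the image of L lies in its kernel. So the kernel has dimension at least 2 and
    contains some f3 outside the line of f2 = L f1. *)
Lemma square_zero_basis : (exists2 u, odd_el u & L u != 0) ->
    (forall u, odd_el u -> L (L u) = 0) ->
  exists f1 f2 f3, [/\ odd_el f1, odd_el f2, odd_el f3 & indep3 f1 f2 f3] /\
    [/\ L f1 = f2, L f2 = 0 & L f3 = 0].
Proof.
case=> f1 Af1 Lf1 LL.
pose h : {linear A -> A} := sa_mul A e.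
pose K := (sa_gr A true :&: lker (linfun h))%VS.
have memK x : (x \in K) = odd_el x && (L x == 0).
  by rewrite memv_cap memv_ker lfunE.
have K2 : (1 < \dim K)%N.
  have := limg_ker_dim (linfun h) (sa_gr A true); rewrite typeA.2 -/K => dK.
  have : (\dim (linfun h @: sa_gr A true) <= \dim K)%N.
    apply/dimvS/subvP=> _ /memv_imgP[x Ax ->]; rewrite memK lfunE /=.
    by rewrite odd_L //= LL.
  by move: dK; case: (\dim K) => [|[|//]]; case: (\dim _) => [|[|[|?]]].
have [f3 Kf3 f3n] : exists2 z, z \in K & z \notin <[L f1]>%VS.
  by apply: exists_notin; rewrite dim_vline (leq_ltn_trans (leq_b1 _)).
move: Kf3; rewrite memK => /andP[Af3 /eqP Lf3].
exists f1, (L f1), f3; split; last by split=> //; exact: LL.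
split=> //; first exact: odd_L.
move=> a b c abc; have a0 : a = 0.
  have := congr1 L abc; rewrite /L !sa_mulDr !sa_mulZr sa_mul0r -!/(L _).
  rewrite LL // Lf3 !scaler0 !addr0 => /eqP.
  by rewrite scaler_eq0 (negPf Lf1) orbF => /eqP.
have c0 : c = 0.
  apply/eqP; apply: contraNT f3n => c0; apply/vlineP; exists (- (b / c)).
  apply: (scalerI c0); rewrite scalerA mulrN mulrC divfK // scaleNr.
  by apply/eqP; rewrite -addr_eq0 addrC -[X in _ == X]abc a0 scale0r add0r.
split=> //; move/eqP: abc; rewrite a0 c0 !scale0r add0r addr0.
by rewrite scaler_eq0 (negPf Lf1) orbF => /eqP.
Qed.

(** The image of L is spanned by f2, its kernel by f2 and f3. If w(f2, f3) <> 0, the algebra is J_5;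
    otherwise, if w(f1, f2) <> 0, it is J_3; if both vanish, it is J_4 or J_2 according to whether
    w(f1, f3) is nonzero. *)
Lemma classify_square_zero : lam = 0 -> (exists2 u, odd_el u & L u != 0) ->
  (forall u, odd_el u -> L (L u) = 0) -> classified.
Proof.
move=> l0 L0 LL.
have [f1 [f2 [f3 [[Af1 Af2 Af3 ind] [L1 L2 L3]]]]] := square_zero_basis L0 LL.
have ee0 : e ** e = 0 by rewrite ee l0 scale0r.
have [r0|r0] := eqVneq (form f2 f3) 0; last first.
  (* Adding elements of the kernel keeps L g1 = f2; [al] makes g1 orthogonal to f3 and [be] makes it
     orthogonal to f2. *)
  pose al := - (form f1 f3 / form f2 f3); pose be := form f1 f2 / form f2 f3.
  pose g1 := f1 + al *: f2 + be *: f3; pose g3 := (form f2 f3)^-1 *: f3.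
  have Ag1 : odd_el g1 by rewrite !rpredD ?rpredZ.
  have Ag3 : odd_el g3 by exact: rpredZ.
  have Lg1 : L g1 = f2.
    by rewrite /L /g1 !sa_mulDr !sa_mulZr -!/(L _) L1 L2 L3 !scaler0 !addr0.
  have Lg3 : L g3 = 0 by rewrite LZ L3 scaler0.
  have g12 : form g1 f2 = 0.
    by rewrite !formDl !formZl form_diag // (formC Af3 Af2) /be; field.
  have g13 : form g1 g3 = 0.
    by rewrite formZr !formDl !formZl form_diag // /al; field.
  have g23 : form f2 g3 = 1 by rewrite formZr mulVf.
  have ind' : indep3 g1 f2 g3.
    have := indep3_scale (oner_neq0 _) (oner_neq0 _) (invr_neq0 r0) (indep3_shearl (a := al) (b := be) ind).
    by rewrite !scale1r.
  by J_basis 4%N g1 f2 g3; rewrite -?/(L _) // formE // ?g12 ?g13 ?g23 ?scale0r ?scale1r.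
have [p0|p0] := eqVneq (form f1 f2) 0.
  have [q0|q0] := eqVneq (form f1 f3) 0.
    by J_basis 1%N f1 f2 f3; rewrite -?/(L _) // formE // ?r0 ?p0 ?q0 ?scale0r.
  pose g3 := (form f1 f3)^-1 *: f3; have Ag3 : odd_el g3 by exact: rpredZ.
  have Lg3 : L g3 = 0 by rewrite LZ L3 scaler0.
  have g13 : form f1 g3 = 1 by rewrite formZr mulVf.
  have g23 : form f2 g3 = 0 by rewrite formZr r0 mulr0.
  have ind' : indep3 f1 f2 g3.
    have := indep3_scale (oner_neq0 _) (oner_neq0 _) (invr_neq0 q0) ind.
    by rewrite !scale1r.
  by J_basis 3%N f1 f2 g3; rewrite -?/(L _) // formE // ?p0 ?g13 ?g23 ?scale0r ?scale1r.
(* Rescaling f1 and f2 = e f1 by t multiplies f1 f2 by t ^ 2.                  *)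
pose t := (sqrtC (form f1 f2))^-1.
have t2 : t * t * form f1 f2 = 1.
  by rewrite -expr2 exprVn sqrtCK mulVf.
have t0 : t != 0 by rewrite invr_eq0 sqrtC_eq0.
pose g1 := t *: f1; pose g2 := t *: f2.
pose g3 := 0 *: f1 + (- (form f1 f3 / form f1 f2)) *: f2 + f3.
have Ag1 : odd_el g1 by exact: rpredZ.
have Ag2 : odd_el g2 by exact: rpredZ.
have Ag3 : odd_el g3 by rewrite !rpredD ?rpredZ.
have Lg1 : L g1 = g2 by rewrite LZ L1.
have Lg2 : L g2 = 0 by rewrite LZ L2 scaler0.
have Lg3 : L g3 = 0.
  by rewrite /L /g3 !sa_mulDr !sa_mulZr -!/(L _) L2 L3 scale0r !scaler0 !addr0.
have g12 : form g1 g2 = 1 by rewrite formZl formZr mulrA.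
have g13 : form g1 g3 = 0.
  by rewrite formZl !formDr !formZr form_diag //; field.
have g23 : form g2 g3 = 0.
  by rewrite formZl !formDr !formZr form_diag // r0; ring.
have ind' : indep3 g1 g2 g3.
  have := indep3_scale t0 t0 (oner_neq0 _)
    (indep3_shearr (a := 0) (b := - (form f1 f3 / form f1 f2)) ind).
  by rewrite scale1r.
by J_basis 2%N g1 g2 g3; rewrite -?/(L _) // formE // ?g12 ?g13 ?g23 ?scale0r ?scale1r.
Qed.

(** For la = 0, [jordan_eeev] says 2 L^3 = 0, so f1, L f1, L^2 f1 is a basis. The Jordan identity on
    this basis forces w = 0. *)
Lemma classify_nilpotent : lam = 0 -> (exists2 u, odd_el u & L (L u) != 0) -> classified.
Proof.
move=> l0 [f1 Af1 L2]; have ee0 : e ** e = 0 by rewrite ee l0 scale0r.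
have L3 u : odd_el u -> L (L (L u)) = 0.
  move=> Au; have := jordan_eeev Au; rewrite l0 expr2 !(mulr0, mul0r) !scale0r add0r.
  by move/eqP; rewrite scaler_eq0 (negPf two0) => /eqP.
pose f2 := L f1; pose f3 := L f2.
have Af2 : odd_el f2 by exact: odd_L.
have Af3 : odd_el f3 by exact: odd_L.
have Lf3 : L f3 = 0 by exact: L3.
have f30 : f3 != 0 by [].
have ind : indep3 f1 f2 f3.
  move=> a b c abc.
  have a0 : a = 0.
    have := congr1 (fun x => L (L x)) abc; rewrite /L !sa_mulDr !sa_mulZr !sa_mul0r.
    rewrite -!/(L _) -!/f2 -!/f3 Lf3 [L 0]sa_mul0r !scaler0 !addr0 => /eqP.
    by rewrite scaler_eq0 (negPf f30) orbF => /eqP.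
  have b0 : b = 0.
    have := congr1 L abc; rewrite a0 scale0r add0r /L !sa_mulDr !sa_mulZr !sa_mul0r.
    rewrite -!/(L _) -!/f3 Lf3 scaler0 addr0 => /eqP.
    by rewrite scaler_eq0 (negPf f30) orbF => /eqP.
  split=> //; move/eqP: abc; rewrite a0 b0 !scale0r !add0r.
  by rewrite scaler_eq0 (negPf f30) orbF => /eqP.
have w23 : form f2 f3 = 0.
  have /eqP := jordan_ueve Af1 Af2; rewrite l0 expr2 !mul0r mulr0 mul0r subrr addr0.
  by rewrite eq_sym mulf_eq0 (negPf two0) => /eqP.
have [w13 w12] : form f1 f3 = 0 /\ form f1 f2 = 0.
  (* This instance amounts to w(f3, f1) f2 - 2 w(f2, f1) f3 = 0. *)
  have := jordan_uvwe Af1 Af2 Af1; rewrite -/f2 -/f3 Lf3 scaler0 subr0 => /eqP.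
  rewrite -subr_eq0 -addrA -opprD -scalerDl -scaleNr => /eqP H.
  have [|_ h3 h2] := ind 0 (form f3 f1) (- (form f2 f1 + form f2 f1)).
    by rewrite scale0r add0r.
  move: h3 h2; rewrite (formC Af3 Af1) (formC Af2 Af1) => /eqP.
  rewrite oppr_eq0 => /eqP-> /eqP; rewrite -opprD opprK -mulr2n mulrn_eq0 => /eqP->.
  by [].
by J_basis 5%N f1 f2 f3; rewrite -?/(L _) // formE // ?w12 ?w13 ?w23 ?scale0r.
Qed.

(** * The case where e is idempotent *)

Definition eigenvalue_triples : seq (F * F * F) :=
  [:: (0, 0, 0); (0, 0, half); (0, 0, 1); (0, half, half); (0, half, 1);
      (0, 1, 1); (half, half, half); (half, half, 1); (half, 1, 1); (1, 1, 1)].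

(** On the odd part [jordan_eeev] reads L (2L - 1)(L - 1) = 0, with simple roots 0, 1/2 and 1, so
    bases of the three eigenspaces together form a basis. *)
Lemma eigenbasis : lam = 1 ->
  exists f1 f2 f3 : A, exists d1 d2 d3 : F,
    [/\ odd_el f1, odd_el f2, odd_el f3 & indep3 f1 f2 f3] /\
    [/\ L f1 = d1 *: f1, L f2 = d2 *: f2, L f3 = d3 *: f3 &
      (d1, d2, d3) \in eigenvalue_triples].
Proof.
move=> l1; have half2 : half * 2%:R = 1 by exact: mulVf.
have L3 u : odd_el u -> L u + 2%:R *: L (L (L u)) = 3%:R *: L (L u).
  by move=> Au; have := jordan_eeev Au; rewrite l1 expr1n scale1r mulr1.
pose h : {linear A -> A} := sa_mul A e.
pose E d : {vspace A} := (sa_gr A true :&: lker (linfun h - d *: \1)%VF)%VS.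
have memE d x : (x \in E d) = odd_el x && (L x == d *: x).
  rewrite memv_cap memv_ker add_lfunE opp_lfunE scale_lfunE id_lfunE lfunE /=.
  by rewrite subr_eq0.
have LD u v : L (u + v) = L u + L v by exact: sa_mulDr.
have E0h : (E 0%R :&: E half = 0)%VS.
  apply/eqP; rewrite -subv0; apply/subvP=> x; rewrite memv_cap !memE memv0.
  case/andP=> /andP[_ /eqP ->] /andP[_]; rewrite scale0r eq_sym scaler_eq0.
  by rewrite invr_eq0 (negPf two0).
have E0h1 : ((E 0%R + E half) :&: E 1%R = 0)%VS.
  apply/eqP; rewrite -subv0; apply/subvP=> x; rewrite memv_cap memv0.
  case/andP=> /memv_addP[y + [z + xyz]]; rewrite !memE.
  case/andP=> _ /eqP Ly /andP[_ /eqP Lz] /andP[_]; rewrite xyz LD Ly Lz !scale0r scale1r.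
  rewrite add0r => /eqP zyz.
  have yz : y = (half - 1) *: z by rewrite scalerBl scale1r zyz addrK.
  have /eqP := congr1 L yz; rewrite LZ Ly Lz scale0r eq_sym scalerA scaler_eq0.
  rewrite mulf_eq0 invr_eq0 (negPf two0) orbF.
  case/orP=> [h0|/eqP z0]; last by rewrite yz z0 scaler0 addr0.
  have : 2%:R * (half - 1) == 0 by rewrite (eqP h0) mulr0.
  by rewrite mulrBr mulr1 mulrC half2 -opprB oppr_eq0 (_ : 2%:R - 1 = 1) ?oner_eq0 //; ring.
have Esum : (E 0%R + E half + E 1%R = sa_gr A true)%VS.
  apply/eqP; rewrite eqEsubv !subv_add !capvSl; apply/subvP=> x Ax.
  pose y := L x; pose z := L y.
  have Ay : odd_el y by exact: odd_L.
  have Az : odd_el z by exact: odd_L.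
  have Lz : L z = half *: (3%:R *: z - y).
    rewrite -(L3 x Ax) -/y -/z addrC addKr.
    by rewrite scalerA half2 scale1r.
  pose c d e' : A := d *: y + e' *: z.
  have Ac d e' : odd_el (c d e') by rewrite rpredD ?rpredZ.
  have Lc d e' : L (c d e') = c (- (half * e')) (d + half * 3%:R * e').
    rewrite /c LD !LZ -/z Lz scalerBr scalerA scalerBr !scalerA.
    rewrite addrA -scalerDl addrC -scaleNr; congr (_ *: _ + _ *: _); ring.
  have cD d e' d' e'' : c d e' + c d' e'' = c (d + d') (e' + e'').
    by rewrite /c addrACA -!scalerDl.
  (* Lagrange interpolation at 0, 1/2, 1: the projections are (1 - L)(1 - 2L), 4L(1 - L) and L(2L -
     1), expanded with y = L x and z = L^2 x. *)
  have x0 : x + c (- 3%:R) 2%:R \in E 0.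
    rewrite memE rpredD //= LD Lc scale0r -/y /c half2 mulrAC half2 mul1r.
    by rewrite addNr scale0r addr0 scaleN1r subrr.
  have xh : c 4%:R (- 4%:R) \in E half.
    rewrite memE Ac Lc /= /c scalerDr !scalerA; apply/eqP.
    congr (_ *: _ + _ *: _); first by ring.
    by rewrite /half; field.
  have x1 : c (- 1) 2%:R \in E 1.
    rewrite memE Ac Lc scale1r /= /c half2; apply/eqP.
    by congr (_ *: _ + _ *: _); rewrite mulrAC half2; ring.
  have -> : x = (x + c (- 3%:R) 2%:R) + c 4%:R (- 4%:R) + c (- 1) 2%:R.
    rewrite -2!addrA -[LHS]addr0; congr (_ + _).
    rewrite !cD (_ : - 3%:R + _ = 0); last by ring.
    by rewrite (_ : 2%:R + _ = 0) ?/c ?scale0r ?addr0 //; ring.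
  by rewrite !memv_add.
have bas : basis_of (sa_gr A true) (vbasis (E 0) ++ vbasis (E half) ++ vbasis (E 1)).
  rewrite catA -Esum; apply: cat_basis; last exact: vbasisP.
    exact/directv_addP.
  by apply: cat_basis; rewrite ?vbasisP //; exact/directv_addP.
have := size_basis (X := in_tuple _) bas; rewrite typeA.2.
have eig d x : x \in (vbasis (E d) : seq A) -> L x = d *: x.
  by move/vbasis_mem; rewrite memE => /andP[_ /eqP].
have := eig 0; have := eig half; have := eig 1; move: bas {eig}.
move: {E0h E0h1 Esum} (vbasis (E 0) : seq A) (vbasis (E half) : seq A) (vbasis (E 1) : seq A).
move=> X0 Xh X1 bas H1 Hh H0.
have [/basis_mem bodd /basis_free bfree] := (bas, bas).
rewrite !size_cat => sz.
set G := ex _.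
have fin f1 f2 f3 d1 d2 d3 : X0 ++ Xh ++ X1 = [:: f1; f2; f3] ->
    L f1 = d1 *: f1 -> L f2 = d2 *: f2 -> L f3 = d3 *: f3 ->
    (d1, d2, d3) \in eigenvalue_triples -> G.
  move=> eX L1 L2 L3' dd; exists f1, f2, f3, d1, d2, d3; rewrite eX in bodd bfree.
  by split; split=> //; rewrite ?bodd ?inE ?eqxx ?orbT //; exact: free_indep3.
(* The dimensions of the three eigenspaces add up to 3 in ten ways, one for each triple. *)
case: X0 H0 sz fin {bas bodd bfree} => [|x [|y [|z [|? ?]]]] H0;
  case: Xh Hh => [|x' [|y' [|z' [|? ?]]]] Hh;
  case: X1 H1 => [|x'' [|y'' [|z'' [|? ?]]]] H1 //= _ fin;
  apply: fin; first [reflexivity | by apply: H0; rewrite !inE eqxx ?orbT |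
    by apply: Hh; rewrite !inE eqxx ?orbT | by apply: H1; rewrite !inE eqxx ?orbT | idtac];
  by rewrite !inE eqxx ?orbT.
Qed.

(** By [form_eigen0] the form pairs only equal nonzero eigenvalues. Among the triples with such a
    pair, [form_half] and [form_eigen_other] leave only (0, 1/2, 1/2), (0, 1, 1) and (1, 1, 1), and
    each of these gives two algebras. *)
Lemma classify_idempotent : lam = 1 -> classified.
Proof.
move=> l1; have [f1 [f2 [f3 [d1 [d2 [d3 [[A1 A2 A3 ind] [L1 L2 L3 dd]]]]]]]] := eigenbasis l1.
have ee1 : e ** e = e by rewrite ee l1 scale1r.
have half2 : half * 2%:R = 1 by exact: mulVf.
have half0 : half != 0 by rewrite invr_eq0.
have half1 : half != 1.
  by apply/eqP => h; move: half2; rewrite h mul1r => /eqP; rewrite -subr_eq0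
    (_ : 2%:R - 1 = 1) ?oner_eq0 //; ring.
have O00 u v : odd_el u -> odd_el v -> L u = 0 *: u -> L v = 0 *: v -> form u v = 0.
  move=> Au Av Lu Lv; apply: (form_eigen0 l1 Au Av Lu Lv).
  by rewrite !(mulr0, mul0r) addr0 subr0 add0r oppr_eq0 oner_eq0.
have O0h u v : odd_el u -> odd_el v -> L u = 0 *: u -> L v = half *: v -> form u v = 0.
  move=> Au Av Lu Lv; apply: (form_eigen0 l1 Au Av Lu Lv).
  by rewrite !(mulr0, mul0r) add0r subr0 subr_eq0.
(* The factor (2a - 1)(1 - b) vanishes when b = 1, so here and in [Oh1] the arguments are
   exchanged. *)
have O01 u v : odd_el u -> odd_el v -> L u = 0 *: u -> L v = 1 *: v -> form u v = 0.
  move=> Au Av Lu Lv; rewrite formC // (form_eigen0 l1 Av Au Lv Lu) ?oppr0 //.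
  by rewrite (_ : _ - 1 = 1) ?oner_eq0 //; ring.
have Oh1 u v : odd_el u -> odd_el v -> L u = half *: u -> L v = 1 *: v -> form u v = 0.
  move=> Au Av Lu Lv; rewrite formC // (form_eigen0 l1 Av Au Lv Lu) ?oppr0 //.
  rewrite (_ : _ - 1 = - (half * half * 2%:R) + 1); last by rewrite /half; field.
  by rewrite -mulrA half2 mulr1 addrC subr_eq0 eq_sym.
have ne0 x y z : indep3 x y z -> [/\ x != 0, y != 0 & z != 0].
  move=> H; split; apply/eqP=> x0.
  - have [|/eqP] := H 1 0 0; first by rewrite x0 !(scaler0, scale0r) !addr0.
    by rewrite oner_eq0.
  - have [|_ /eqP] := H 0 1 0; first by rewrite x0 !(scaler0, scale0r) !addr0.
    by rewrite oner_eq0.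
  have [|_ _ /eqP] := H 0 0 1; first by rewrite x0 !(scaler0, scale0r) !addr0.
  by rewrite oner_eq0.
have [f10 f20 f30] := ne0 _ _ _ ind.
have sc3 g : g != 0 -> indep3 f1 f2 (g *: f3).
  by move=> g0; have := indep3_scale (oner_neq0 _) (oner_neq0 _) g0 ind; rewrite !scale1r.
have S1 x : 1 *: x = x :> A by rewrite scale1r.
have S0 x : 0 *: x = 0 :> A by rewrite scale0r.
move: dd; rewrite /eigenvalue_triples !inE; do 9?[case/orP]; move=> /eqP[e1 e2 e3];
  rewrite {}e1 in L1; rewrite {}e2 in L2; rewrite {}e3 in L3.
- have := O00 _ _ A1 A2 L1 L2; have := O00 _ _ A1 A3 L1 L3; have := O00 _ _ A2 A3 L2 L3.
  move: L1 L2 L3; rewrite !S0 => L1 L2 L3 w23 w13 w12.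
  by J_basis 6%N f1 f2 f3; rewrite -?/(L _) // formE // ?w12 ?w13 ?w23 ?scale0r.
- have := O00 _ _ A1 A2 L1 L2; have := O0h _ _ A1 A3 L1 L3; have := O0h _ _ A2 A3 L2 L3.
  move: L1 L2 L3; rewrite !S0 => L1 L2 L3 w23 w13 w12.
  by J_basis 7%N f1 f2 f3; rewrite -?/(L _) // formE // ?w12 ?w13 ?w23 ?scale0r.
- have := O00 _ _ A1 A2 L1 L2; have := O01 _ _ A1 A3 L1 L3; have := O01 _ _ A2 A3 L2 L3.
  move: L1 L2 L3; rewrite !S0 !S1 => L1 L2 L3 w23 w13 w12.
  by J_basis 8%N f1 f2 f3; rewrite -?/(L _) // formE // ?w12 ?w13 ?w23 ?scale0r.
- have := O0h _ _ A1 A2 L1 L2; have := O0h _ _ A1 A3 L1 L3.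
  move: L1 L2 L3; rewrite !S0 => L1 L2 L3 w13 w12.
  have [w23|w23] := eqVneq (form f2 f3) 0.
    by J_basis 9%N f1 f2 f3; rewrite -?/(L _) // formE // ?w12 ?w13 ?w23 ?scale0r.
  pose g3 := (form f2 f3)^-1 *: f3; have Ag3 : odd_el g3 by exact: rpredZ.
  have ind' : indep3 f1 f2 g3 by apply: sc3; rewrite invr_eq0.
  have g13 : form f1 g3 = 0 by rewrite formZr w13 mulr0.
  have g23 : form f2 g3 = 1 by rewrite formZr mulVf.
  have Lg3 : L g3 = half *: g3 by rewrite LZ L3 !scalerA mulrC.
  by J_basis 10%N f1 f2 g3; rewrite -?/(L _) // formE // ?w12 ?g13 ?g23 ?scale0r ?scale1r.
- have := O0h _ _ A1 A2 L1 L2; have := O01 _ _ A1 A3 L1 L3; have := Oh1 _ _ A2 A3 L2 L3.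
  move: L1 L2 L3; rewrite !S0 !S1 => L1 L2 L3 w23 w13 w12.
  by J_basis 11%N f1 f2 f3; rewrite -?/(L _) // formE // ?w12 ?w13 ?w23 ?scale0r.
- have := O01 _ _ A1 A2 L1 L2; have := O01 _ _ A1 A3 L1 L3.
  move: L1 L2 L3; rewrite !S0 !S1 => L1 L2 L3 w13 w12.
  have [w23|w23] := eqVneq (form f2 f3) 0.
    by J_basis 12%N f1 f2 f3; rewrite -?/(L _) // formE // ?w12 ?w13 ?w23 ?scale0r.
  pose g3 := (form f2 f3)^-1 *: f3; have Ag3 : odd_el g3 by exact: rpredZ.
  have ind' : indep3 f1 f2 g3 by apply: sc3; rewrite invr_eq0.
  have g13 : form f1 g3 = 0 by rewrite formZr w13 mulr0.
  have g23 : form f2 g3 = 1 by rewrite formZr mulVf.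
  have Lg3 : L g3 = g3 by rewrite LZ L3.
  by J_basis 13%N f1 f2 g3; rewrite -?/(L _) // formE // ?w12 ?g13 ?g23 ?scale0r ?scale1r.
- have [w12 w13 w23] := form_half l1 A1 A2 A3 L1 L2 L3 ind.
  by J_basis 14%N f1 f2 f3; rewrite -?/(L _) // formE // ?w12 ?w13 ?w23 ?scale0r.
- have w13 := Oh1 _ _ A1 A3 L1 L3; have w23 := Oh1 _ _ A2 A3 L2 L3.
  have w32 : form f3 f2 = 0 by rewrite formC // w23 oppr0.
  have w12 : form f1 f2 = 0.
    by apply: (form_eigen_other A3 A1 A2 f30 L3 L1 L2 w32); rewrite ?oner_neq0.
  move: L3; rewrite S1 => L3'.
  by J_basis 15%N f1 f2 f3; rewrite -?/(L _) // formE // ?w12 ?w13 ?w23 ?scale0r.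
- have w12 := Oh1 _ _ A1 A2 L1 L2; have w13 := Oh1 _ _ A1 A3 L1 L3.
  have w23 : form f2 f3 = 0.
    by apply: (form_eigen_other A1 A2 A3 f10 L1 L2 L3 w13); rewrite // eq_sym.
  move: L2 L3; rewrite !S1 => L2' L3'.
  by J_basis 16%N f1 f2 f3; rewrite -?/(L _) // formE // ?w12 ?w13 ?w23 ?scale0r.
(* In the case (1, 1, 1) L is the identity, so any basis adapted to the form will do. *)
have Lid u : odd_el u -> L u = u.
  move=> /(indep3_span typeA.2 A1 A2 A3 ind)[a [b [c ->]]].
  by rewrite /L !sa_mulDr !sa_mulZr -!/(L _) L1 L2 L3 !scale1r.
have [[u [v [Au Av uv]]]|no] := pselect (exists u v, [/\ odd_el u, odd_el v & form u v != 0]).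
  have [g1 [g2 [g3 [[Ag1 Ag2 Ag3 ind'] [w12 w13 w23]]]]] := symplectic_basis Au Av uv.
  have Lg1 := Lid _ Ag1; have Lg2 := Lid _ Ag2; have Lg3 := Lid _ Ag3.
  by J_basis 18%N g1 g2 g3; rewrite -?/(L _) // formE // ?w12 ?w13 ?w23 ?scale0r ?scale1r.
have w0 u v : odd_el u -> odd_el v -> form u v = 0.
  by move=> Au Av; apply/eqP/negPn/negP => uv; apply: no; exists u, v.
move: L1 L2 L3; rewrite !S1 => L1 L2 L3.
by J_basis 17%N f1 f2 f3; rewrite -?/(L _) // formE // w0 // scale0r.
Qed.

End Fixed.

Lemma classification : nonzero_product A -> exists i : 'I_19, sa_iso A (J_ F i).
Proof.
move=> nz; have [e e0 Ae] := dim1_vline typeA.1.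
have Aee : e \in sa_gr A false by rewrite Ae memv_line.
have [lam ee] : exists lam, e ** e = lam *: e.
  by apply/vlineP; rewrite -Ae; exact: (sa_graded Aee Aee).
have [l0|l0] := eqVneq lam 0; last first.
  (* Dividing e by [lam] makes it idempotent. *)
  have e0' : lam^-1 *: e != 0 by rewrite scaler_eq0 invr_eq0 (negPf l0).
  apply: (@classify_idempotent (lam^-1 *: e) e0' _ 1) => //.
    by apply/esym/eqP; rewrite eqEdim -memvE Ae memvZ ?memv_line //= !dim_vline e0 e0'.
  by rewrite sa_mulZl sa_mulZr ee scale1r !scalerA -mulrA mulVf // mulr1.
have [[u [Au LLu]]|LL] := pselect (exists u, u \in sa_gr A true /\ e ** (e ** u) != 0).
  by apply: (classify_nilpotent e0 Ae ee l0); exists u.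
have [[u [Au Lu]]|L0] := pselect (exists u, u \in sa_gr A true /\ e ** u != 0).
  apply: (classify_square_zero e0 Ae ee l0); first by exists u.
  by move=> v Av; apply/eqP/negPn/negP => vv; apply: LL; exists v.
apply: (classify_zero e0 Ae ee l0) => // v Av.
by apply/eqP/negPn/negP => vv; apply: L0; exists v.
Qed.

End Classification.

Theorem theorem10 (R : realType) :
  let C : fieldType := R[i] in
  (forall i, has_type (J_ C i) 1 3 /\ jordan_superalgebra (J_ C i)
             /\ nonzero_product (J_ C i)) /\
  (forall i j, sa_iso (J_ C i) (J_ C j) -> i = j) /\
  (forall A : superalgebra C, has_type A 1 3 -> jordan_superalgebra A ->
     nonzero_product A -> exists! i, sa_iso A (J_ C i)) /\
  (
   (orbit_dim (J_1 C) = 6%N /\ sa_iso (J_1 C) (dsum (S_2_3 C) (S_1_1 C))) /\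
   (orbit_dim (J_2 C) = 7%N /\ sa_iso (J_2 C) (dsum (S_3_3 C) (S_1_1 C))) /\
   (orbit_dim (J_3 C) = 10%N /\ sa_iso (J_3 C) (dsum (S_1_3 C) (S_1_1 C))) /\
   (orbit_dim (J_4 C) = 9%N /\ indecomposable (J_4 C)) /\
   (orbit_dim (J_5 C) = 12%N /\ indecomposable (J_5 C)) /\
   (orbit_dim (J_6 C) = 11%N /\ indecomposable (J_6 C)) /\
   (orbit_dim (J_7 C) = 7%N /\ sa_iso (J_7 C) (dsum (U_1 C) (dsum (S_1_1 C) (dsum (S_1_1 C) (S_1_1 C))))) /\
   (orbit_dim (J_8 C) = 10%N /\ sa_iso (J_8 C) (dsum (S_1_2 C) (dsum (S_1_1 C) (S_1_1 C)))) /\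
   (orbit_dim (J_9 C) = 10%N /\ sa_iso (J_9 C) (dsum (S_2_2 C) (dsum (S_1_1 C) (S_1_1 C)))) /\
   (orbit_dim (J_10 C) = 9%N /\ sa_iso (J_10 C) (dsum (S_5_3 C) (S_1_1 C))) /\
   (orbit_dim (J_11 C) = 10%N /\ sa_iso (J_11 C) (dsum (S_7_3 C) (S_1_1 C))) /\
   (orbit_dim (J_12 C) = 12%N /\ sa_iso (J_12 C) (dsum (S_4_3 C) (S_1_1 C))) /\
   (orbit_dim (J_13 C) = 11%N /\ sa_iso (J_13 C) (dsum (S_6_3 C) (S_1_1 C))) /\
   (orbit_dim (J_14 C) = 12%N /\ sa_iso (J_14 C) (dsum (S_8_3 C) (S_1_1 C))) /\
   (orbit_dim (J_15 C) = 4%N /\ indecomposable (J_15 C)) /\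
   (orbit_dim (J_16 C) = 9%N /\ indecomposable (J_16 C)) /\
   (orbit_dim (J_17 C) = 10%N /\ indecomposable (J_17 C)) /\
   (orbit_dim (J_18 C) = 7%N /\ indecomposable (J_18 C)) /\
   (orbit_dim (J_19 C) = 10%N /\ indecomposable (J_19 C))
  ) /\
  (
   indecomposable (U_1 C) /\
   indecomposable (S_1_1 C) /\
   indecomposable (S_1_2 C) /\
   indecomposable (S_2_2 C) /\
   indecomposable (S_1_3 C) /\
   indecomposable (S_2_3 C) /\
   indecomposable (S_3_3 C) /\
   indecomposable (S_4_3 C) /\
   indecomposable (S_5_3 C) /\
   indecomposable (S_6_3 C) /\
   indecomposable (S_7_3 C) /\
   indecomposable (S_8_3 C)
  ).
Proof.
have hd i := J_orbit_dim R[i] i.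
split; first by move=> i; split; [exact: J_type | split; [exact: J_jordan | exact: J_nonzero]].
split; first by move=> i j; exact: J_iso_inj.
split.
  move=> A tA [scA jA] nz; have [i Ai] := classification tA scA jA nz.
  exists i; split=> // j Aj; apply: (@J_iso_inj R[i]).
  exact: sa_iso_trans (sa_iso_sym Ai) Aj.
pose o k (k19 : (k < 19)%N) := hd (Ordinal k19).
split.
  split; [split; [exact: (o 0%N isT) | exact: J_1_iso] |].
  split; [split; [exact: (o 1%N isT) | exact: J_2_iso] |].
  split; [split; [exact: (o 2%N isT) | exact: J_3_iso] |].
  split; [split; [exact: (o 3%N isT) | exact: J_4_indec] |].
  split; [split; [exact: (o 4%N isT) | exact: J_5_indec] |].
  split; [split; [exact: (o 5%N isT) | exact: J_6_indec] |].
  split; [split; [exact: (o 6%N isT) | exact: J_7_iso] |].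
  split; [split; [exact: (o 7%N isT) | exact: J_8_iso] |].
  split; [split; [exact: (o 8%N isT) | exact: J_9_iso] |].
  split; [split; [exact: (o 9%N isT) | exact: J_10_iso] |].
  split; [split; [exact: (o 10%N isT) | exact: J_11_iso] |].
  split; [split; [exact: (o 11%N isT) | exact: J_12_iso] |].
  split; [split; [exact: (o 12%N isT) | exact: J_13_iso] |].
  split; [split; [exact: (o 13%N isT) | exact: J_14_iso] |].
  split; [split; [exact: (o 14%N isT) | exact: J_15_indec] |].
  split; [split; [exact: (o 15%N isT) | exact: J_16_indec] |].
  split; [split; [exact: (o 16%N isT) | exact: J_17_indec] |].
  split; [split; [exact: (o 17%N isT) | exact: J_18_indec] |].
  by split; [exact: (o 18%N isT) | exact: J_19_indec].
split; first exact: U_1_indec.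
split; first exact: S_1_1_indec.
split; first exact: S_1_2_indec.
split; first exact: S_2_2_indec.
split; first exact: S_1_3_indec.
split; first exact: S_2_3_indec.
split; first exact: S_3_3_indec.
split; first exact: S_4_3_indec.
split; first exact: S_5_3_indec.
split; first exact: S_6_3_indec.
split; first exact: S_7_3_indec.
exact: S_8_3_indec.
Qed.
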